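(* Let $\Bbbk$ be a field of characteristic $0$, let $M=\mathbb{Z}^n$, let $Q$ be a toric monoid with group completion $Q^{\mathrm{gp}}$, and let $P\subseteq M\oplus Q^{\mathrm{gp}}$ be a toric submonoid with $P^\times=\{0\}$ (only trivial units). Write $m\mapsto \bar m$ for the projection $M\oplus Q^{\mathrm{gp}}\to M$, and assume that $Q$ (viewed as $0\oplus Q$) equals $\{m\in P\mid \bar m=0\}$. Let $S=\{m_1,\ldots,m_r\}\subset P$ be a finite set with $\bar m_i\neq 0$ for all $i$, and let $$f=1+\sum_{m\in S} z^m+g\in\widehat{\Bbbk[P]},\qquad g=\sum_{q\in Q\setminus\{0\}} b_q z^q\in\widehat{\Bbbk[Q]},$$ be normalized, i.e. the power series $\log f\in\widehat{\Bbbk[P]}$ contains no monomial of the form $z^q$ with $q\in Q\setminus\{0\}$. Then in $\widehat{\Bbbk[P]}$ $$f=\prod_{\{m\in P\,\mid\, \bar m\neq 0\}}(1+a_m z^m)$$ with $$a_m=\sum_{\Gamma\in\mathscr{T}_m(S)}(-1)^{|\hat V_\Gamma|}\qquad (m\in P,\ \bar m\neq 0),$$ and $$b_q=\sum_{\tilde\Gamma\in\mathscr{R}_q(S)}(-1)^{|\hat V_{\tilde\Gamma}|-1}\qquad (q\in Q\setminus\{0\}).$$ Here $\mathscr{T}_m(S)$ is the set of types of $P$-labelled tropical disks with leaf labels in $S$ and root label $m$, $\mathscr{R}_q(S)$ is the set of types of $P$-labelled pointed rational tropical curves with leaf labels in $S$ and root label $q$, and $\hat V_\Gamma$ is the set of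 non-leaf vertices of $\Gamma$.
   Context: A toric monoid is a finitely generated, integral (cancellative), saturated commutative monoid whose group completion is torsion-free. $\widehat{\Bbbk[P]}$ is the completion of the monoid algebra $\Bbbk[P]$ with respect to the ideal generated by the monomials $z^m$, $m\in P\setminus\{0\}$; $\widehat{\Bbbk[Q]}\subseteq\widehat{\Bbbk[P]}$ is the analogous completion of $\Bbbk[Q]$. For $f\in\widehat{\Bbbk[P]}$ with constant term $1$, $\log f$ is defined by the Taylor series $\log(1+x)=\sum_{i\ge1}(-1)^{i+1}x^i/i$. Rooted trees: a rooted tree is a partially ordered finite set with a unique maximal element, called the root vertex, which is connected and without cycles when viewed as a graph. The predecessors of a vertex $v$ are the adjacent vertices that are smaller than $v$. The leaves are the minimal elements, i.e. the vertices without predecessors. It is required that no vertex has exactly one predecessor. (A tree consisting of a single vertex is allowed; its root is then also a leaf.) $V_\Gamma$ denotes the set of vertices of a rooted tree $\Gamma$ and $\hat V_\Gamma\subseteq V_\Gamma$ the set of its non-leaf vertices. The type of a $P$-labelled tropical disk is a rooted tree $\Gamma$ together with a vertex-labelling map $V_\Gamma\to P\setminus Q$, $v\mapsto m_v$, such that: (1) (balancing) for any non-leaf vertex $v$ with predecessors $v_1,\ldots,v_\ell$ one has $m_v=m_{v_1}+\cdots+m_{v_\ell}$; (2) for any vertex $v$, the labels of the predecessors of $v$ are pairwise distinct. The type of a $P$-labelled pointed rational tropical curve is defined in the same way, except that the label of the root vertex is required to lie in $Q$ rather than in $P\setminus Q$ (all other vertices are still labelled by elements of $P\setminus Q$). Types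 are considered up to isomorphism of labelled rooted trees. The root label of $\Gamma$ is denoted $m_\Gamma$. For $m\in P$ with $\bar m\ne0$, $\mathscr{T}_m(S)$ is the set of types of $P$-labelled tropical disks $\Gamma$ with $m_\Gamma=m$ and all leaf labels in $S$; for $q\in Q$, $\mathscr{R}_q(S)$ is the set of types of $P$-labelled pointed rational tropical curves $\Gamma$ with $m_\Gamma=q$ and all leaf labels in $S$. *)

(* Defs.v *)
From HB Require Import structures.
From mathcomp Require Import all_boot all_order all_algebra finmap all_classical.

Set Implicit Arguments.
Unset Strict Implicit.
Unset Printing Implicit Defensive.

Import GRing.Theory.
Local Open Scope classical_set_scope.
Local Open Scope ring_scope.

(* An integral commutative monoid embeds in its group completion, so toric
   monoids are given as subsets A of an abelian group G; integrality is then
   automatic, and the group completion is the subgroup [gp A] of G. *)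

Definition gp (G : zmodType) (A : set G) : set G :=
  [set x - y | x in A & y in A].

Definition submonoid (G : zmodType) (A : set G) : Prop :=
  A 0 /\ forall x y, A x -> A y -> A (x + y).

Definition finitely_generated (G : zmodType) (A : set G) : Prop :=
  exists (r : nat) (e : 'I_r -> G),
    A = [set \sum_(i < r) e i *+ c i | c in [set: 'I_r -> nat]].

Definition saturated (G : zmodType) (A : set G) : Prop :=
  forall (x : G) (d : nat), gp A x -> (0 < d)%N -> A (x *+ d) -> A x.

Definition torsion_free (G : zmodType) (B : set G) : Prop :=
  forall (x : G) (d : nat), B x -> (0 < d)%N -> x *+ d = 0 -> x = 0.

Definition toric_monoid (G : zmodType) (A : set G) : Prop :=
  [/\ submonoid A, finitely_generated A, saturated A & torsion_free (gp A)].

Definition trivial_units (G : zmodType) (A : set G) : Prop :=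
  forall x, A x -> A (- x) -> x = 0.

(* The element sum_m (f m) z^m of the completion of k[P] is the function
   f : T -> k of its coefficients, T being an abelian group containing P; f
   vanishes outside P.  For P finitely generated with trivial units, k[P]/I^j
   (I the ideal generated by the z^m, m in P \ {0}) has as basis the finitely
   many m in P that are not in [power_exponents P j], each m in P lies in only
   finitely many [power_exponents P j], and hence lim_j k[P]/I^j consists of
   all such f.  The kernel of the map to k[P]/I^j is [adic P j].
   Sums and differences of series are pointwise, but the pointwise product
   and the constant function 1 are NOT the ring structure of the completion:
   these are [conv] and [zmon 1 0]. *)

Definition power_series (T : zmodType) (k : fieldType) (A : set T) :
    set (T -> k) :=
  [set f | forall m, f m != 0 -> A m].

Definition zmon (T : zmodType) (k : fieldType) (c : k) (m : T) : T -> k :=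
  fun x => if x == m then c else 0.

Definition zsum (T : zmodType) (k : fieldType) (A : set T) (c : T -> k) :
    T -> k :=
  fun x => if x \in A then c x else 0.

(* For f, g supported on P as above, only the finitely many x in P with
   m - x in P contribute. *)
Definition conv (T : zmodType) (k : fieldType) (f g : T -> k) : T -> k :=
  fun m => \sum_(x \in [set: T]) f x * g (m - x).

Definition conv_exp (T : zmodType) (k : fieldType) (f : T -> k) (i : nat) :
    T -> k :=
  iter i (conv f) (zmon 1 0).

(* The exponents of the monomials in I^j. *)
Definition power_exponents (T : zmodType) (P : set T) (j : nat) : set T :=
  [set m | exists (s : 'I_j -> T) (p : T),
     [/\ forall i, P (s i) /\ s i != 0, P p & m = \sum_(i < j) s i + p]].

Definition adic (T : zmodType) (k : fieldType) (P : set T) (j : nat) :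
    set (T -> k) :=
  power_series (power_exponents P j).

Definition log_partial (T : zmodType) (k : fieldType) (f : T -> k) (N : nat) :
    T -> k :=
  \sum_(1 <= i < N)
    (((-1) ^+ i.+1 / i%:R) \*o conv_exp (f - zmon 1 0) i).

Definition is_log (T : zmodType) (k : fieldType) (P : set T)
    (f L : T -> k) : Prop :=
  power_series P L /\
  forall j, exists N0, forall N, (N0 <= N)%N -> adic P j (L - log_partial f N).

Definition normalized (T : zmodType) (k : fieldType) (P Q : set T)
    (f : T -> k) : Prop :=
  exists L, is_log P f L /\ forall q, Q q -> q != 0 -> L q = 0.

Definition finite_product (T : zmodType) (k : fieldType) (F : T -> T -> k)
    (A : {fset T}) : T -> k :=
  \big[@conv T k / zmon 1 0]_(m <- A) F m.

(* f is the unordered infinite product of the series F m, m in D: the net of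
   the products over finite subsets of D converges to f. *)
Definition is_product (T : zmodType) (k : fieldType) (P D : set T)
    (F : T -> T -> k) (f : T -> k) : Prop :=
  forall j, exists2 A0 : {fset T}, [set` A0] `<=` D &
    forall A : {fset T}, [set` A0] `<=` [set` A] -> [set` A] `<=` D ->
      adic P j (f - finite_product F A).

Section RootedTrees.
Variables (V : finType) (le : rel V).

Definition predecessor (v u : V) : bool :=
  [&& u != v, le u v & [forall w, le u w && le w v ==> (w == u) || (w == v)]].

Definition adjacent : rel V :=
  [rel u v | predecessor u v || predecessor v u].

Definition maximal (r : V) : bool := [forall w, le r w ==> (w == r)].

Definition leaf (v : V) : bool := [forall u, ~~ predecessor v u].

Definition rooted_tree : Prop :=
  [/\ reflexive le, antisymmetric le & transitive le] /\
  [/\ exists! r, maximal r,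
      forall u v, connect adjacent u v,
      (* a cycle of a simple graph has at least three vertices *)
      forall c : seq V, ucycle adjacent c -> (size c <= 2)%N &
      forall v, #|predecessor v| != 1%N].

End RootedTrees.

(* Up to isomorphism the vertex set may be taken to be {0, ..., tsize - 1};
   the order relation on it is [tle], unrelated to that of the integers. *)
Record ltree (T : zmodType) := LTree {
  tsize : nat;
  tle : rel 'I_tsize;
  label : 'I_tsize -> T
}.

HB.instance Definition _ (T : zmodType) := gen_eqMixin (ltree T).
HB.instance Definition _ (T : zmodType) := gen_choiceMixin (ltree T).

Definition ltree_iso (T : zmodType) (G H : ltree T) : Prop :=
  exists phi : 'I_(tsize G) -> 'I_(tsize H),
    [/\ bijective phi,
        forall u v, tle (phi u) (phi v) = tle u v &
        forall v, label (phi v) = label v].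

Definition ltree_isob (T : zmodType) : rel (ltree T) :=
  fun G H => `[< ltree_iso G H >].

Lemma ltree_isob_refl (T : zmodType) : reflexive (@ltree_isob T).
Proof. by move=> G; apply/asboolP; exists id; split=> //; exists id. Qed.

Lemma ltree_isob_sym (T : zmodType) : symmetric (@ltree_isob T).
Proof.
suff impl (G H : ltree T) : ltree_isob G H -> ltree_isob H G.
  by move=> G H; apply/idP/idP; apply: impl.
move=> /asboolP[phi [[psi phiK psiK] phi_le phi_lab]]; apply/asboolP.
exists psi; split=> [|u v|v]; first by exists phi.
- by rewrite -phi_le !psiK.
- by rewrite -phi_lab psiK.
Qed.

Lemma ltree_isob_trans (T : zmodType) : transitive (@ltree_isob T).
Proof.
move=> H G K /asboolP[phi [phi_bij phi_le phi_lab]].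
move=> /asboolP[psi [psi_bij psi_le psi_lab]]; apply/asboolP.
exists (psi \o phi); split=> [|u v|v] /=; first exact: bij_comp.
- by rewrite psi_le phi_le.
- by rewrite psi_lab phi_lab.
Qed.

Canonical ltree_iso_equiv (T : zmodType) :=
  EquivRel (@ltree_isob T) (@ltree_isob_refl T) (@ltree_isob_sym T)
    (@ltree_isob_trans T).

Definition ltree_class (T : zmodType) :=
  {eq_quot (@ltree_iso_equiv T)}%qT.

Definition type_of (T : zmodType) (G : ltree T) : ltree_class T :=
  (\pi_(ltree_class T) G)%qT.

Definition is_root (T : zmodType) (G : ltree T) (v : 'I_(tsize G)) : bool :=
  maximal (@tle T G) v.

Definition balanced (T : zmodType) (G : ltree T) : Prop :=
  forall v : 'I_(tsize G), ~~ leaf (@tle T G) v ->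
    label v = \sum_(u | predecessor (@tle T G) v u) label u.

Definition distinct_predecessors (T : zmodType) (G : ltree T) : Prop :=
  forall v u w : 'I_(tsize G),
    predecessor (@tle T G) v u -> predecessor (@tle T G) v w ->
    label u = label w -> u = w.

Definition tropical_disk (T : zmodType) (P Q : set T) (G : ltree T) : Prop :=
  [/\ rooted_tree (@tle T G),
      forall v : 'I_(tsize G), (P `\` Q) (label v),
      balanced G & distinct_predecessors G].

Definition tropical_curve (T : zmodType) (P Q : set T) (G : ltree T) : Prop :=
  [/\ rooted_tree (@tle T G),
      forall v : 'I_(tsize G),
        if is_root v then Q (label v) else (P `\` Q) (label v),
      balanced G & distinct_predecessors G].

Definition root_label (T : zmodType) (G : ltree T) (m : T) : Prop :=
  forall v : 'I_(tsize G), is_root v -> label v = m.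

Definition leaf_labels_in (T : zmodType) (G : ltree T) (S : {fset T}) : Prop :=
  forall v : 'I_(tsize G), leaf (@tle T G) v -> label v \in S.

(* For P and S as in the theorem, [disk_types P Q S m] and [curve_types P Q S q]
   are finite: m is the sum of the leaf labels, which bounds the number of
   leaves and, no vertex having exactly one predecessor, of vertices.  The sums
   over these sets are thus finite sums. *)
Definition disk_types (T : zmodType) (P Q : set T) (S : {fset T}) (m : T) :
    set (ltree_class T) :=
  [set type_of G | G in
    [set G | [/\ tropical_disk P Q G, root_label G m & leaf_labels_in G S]]].

Definition curve_types (T : zmodType) (P Q : set T) (S : {fset T}) (q : T) :
    set (ltree_class T) :=
  [set type_of G | G in
    [set G | [/\ tropical_curve P Q G, root_label G q & leaf_labels_in G S]]].

(* The number of non-leaf vertices is invariant under isomorphism. *)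
Definition nonleaves (T : zmodType) (X : ltree_class T) : nat :=
  let G := (repr X : ltree T) in
  #|[set v : 'I_(tsize G) | ~~ leaf (@tle T G) v]%SET|.

Definition zero_oplus (n : nat) (G : zmodType) (Q : set G) :
    set ('rV[int]_n * G)%type :=
  [set (0, q) | q in Q].
Arguments zero_oplus n {G} Q.

(* Main.v *)
Require Import Defs.
From HB Require Import structures.
From mathcomp Require Import all_boot all_order all_algebra finmap all_classical.

(* Cutting a tree at its root turns a tropical disk with root label m into either
   a single leaf or a forest with pairwise distinct root labels, at least two of
   them, with sum m.  A forest with root labels in A and sum y either avoids a
   given label x or contains exactly one tree with root label x, so the signed
   number E_A(y) of such forests satisfies
     E_{A + x}(y) = E_A(y) + a_x E_A(y - x),
   and E_A(y) is the coefficient of z^y in the product of the 1 + a_m z^m, m in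
   A.  The cut at the root shows E(m) = [m in S] for m outside Q, whereas E(q) is
   the signed number of curves for q in Q.  It remains to see that f has the
   coefficients E(q) at q in Q.  The logarithm of the product is the sum of the
   log (1 + a_m z^m), which contain only multiples of elements outside Q, hence
   the product is normalized; and two normalized series that agree outside Q
   are equal, because in a given degree the logarithm is the series itself plus a
   polynomial in the coefficients of lower degree.  Here the degree of x in P is
   the largest length of a factorization of x into nonzero elements of P. *)

Set Implicit Arguments.
Unset Strict Implicit.
Unset Printing Implicit Defensive.

Import GRing.Theory.
Local Open Scope classical_set_scope.
Local Open Scope ring_scope.

(** * The degree on a finitely generated monoid with trivial units *)

(** Sums over isomorphism classes are hard to cut and paste directly. Since siblings carry distinct
    labels, a vertex is determined by the labels met on the way to it; a type thus becomes a finite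
    set of words, on which grafting and pruning are explicit inverse operations. On all functions
    [T -> k], [conv] is not a ring product, because supports may be arbitrary. Identities are
    therefore checked after truncation to exponents of degree at most N. These quotients are
    finite-dimensional commutative rings in which z^m is nilpotent for every nonzero m in P, so the
    logarithm becomes a polynomial, and its additivity a statement about nilpotent elements, proved
    by formal differentiation. Characteristic 0 supplies the coefficients 1/i. The infinite product
    is never formed: a coefficient of degree d is the same for all finite products that contain the
    factors of degree at most d. That factorization lengths are bounded at all rests on Dickson's
    lemma: two comparable ways to write the same element differ by a relation with nonnegative
    coefficients, which would produce a nontrivial unit. *)

(** Jumping again and again to an index where the remaining tail attains its minimum can never
    decrease the value. *)
Lemma nondecreasing_subsequence (v : nat -> nat) :
  exists phi : nat -> nat,
    (forall i, phi i < phi i.+1)%N /\ forall i j, (i <= j -> v (phi i) <= v (phi j))%N.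
Proof.
have /choice[mu muP] : forall n, exists l, (n <= l)%N /\
    forall p, (n <= p)%N -> (v l <= v p)%N.
  move=> n.
  pose A := fun y => `[< exists2 l, (n <= l)%N & v l = y >].
  have exA : exists y, A y by exists (v n); apply/asboolP; exists n.
  have := ex_minnP exA => -[y /asboolP[l nl <-] min].
  by exists l; split=> // p np; apply: min; apply/asboolP; exists p.
pose phi := fix F i := if i is j.+1 then mu (F j).+1 else mu 0%N.
have phiS i : (phi i < phi i.+1)%N by case: (muP (phi i).+1).
have min i p : (phi i <= p)%N -> (v (phi i) <= v p)%N.
  case: i => [|i] le_p; first by apply: (proj2 (muP 0%N)).
  have [_ h] := muP (phi i).+1; apply: h.
  exact: leq_trans (phiS i) le_p.
exists phi; split=> // i j ij; apply: min.
by apply: (homo_leq (r := leq)) ij => // [? ? ?|l]; [apply: leq_trans|apply: ltnW].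
Qed.

(** One coordinate is treated at a time: passing to a further subsequence keeps the earlier
    coordinates nondecreasing. *)
Lemma dickson (I : finType) (u : nat -> I -> nat) :
  exists i j, (i < j)%N /\ forall t, (u i t <= u j t)%N.
Proof.
suff [phi [phiS phi_le]] : exists phi : nat -> nat,
    (forall i, phi i < phi i.+1)%N /\
    forall t, t \in enum I -> forall i j, (i <= j -> u (phi i) t <= u (phi j) t)%N.
  exists (phi 0%N), (phi 1%N); split=> // t.
  by apply: phi_le; rewrite ?mem_enum.
elim: (enum I) => [|t s [phi [phiS phi_le]]]; first by exists id.
have [psi [psiS psi_le]] := nondecreasing_subsequence (fun i => u (phi i) t).
have mono_phi : {homo phi : i j / (i < j)%N}.
  by apply: homo_ltn => //; apply: ltn_trans.
have mono_psi : {homo psi : i j / (i <= j)%N}.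
  by apply: homo_leq => // [? ? ?|i]; [apply: leq_trans|apply: ltnW].
exists (phi \o psi); split=> [i|t' /=]; first exact: mono_phi.
rewrite inE => /orP[/eqP->|t's] i j ij; first exact: psi_le.
by apply: phi_le => //; apply: mono_psi.
Qed.

(** Only superadditivity can be expected: in the monoid generated by 2 and 3 the element 3 has
    degree 1, but 3 + 3 = 2 + 2 + 2 has degree 3. *)
Record degree (T : zmodType) (P : set T) (deg : T -> nat) : Prop := Degree {
  degree_in0 : P 0;
  degree_inD : forall x y, P x -> P y -> P (x + y);
  degree0 : deg 0%R = 0%N;
  degree_gt0 : forall x, P x -> x != 0 -> (0 < deg x)%N;
  degreeD : forall x y, P x -> P y -> (deg x + deg y <= deg (x + y)%R)%N;
  degree_ball : forall N, finite_set [set x | P x /\ (deg x <= N)%N]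
}.

Section Degree.
Variables (T : zmodType) (P : set T).
Hypotheses (P0 : P 0) (PD : forall x y, P x -> P y -> P (x + y)).
Hypotheses (finP : finitely_generated P) (unitP : trivial_units P).

Let pe := power_exponents P.

Lemma power_exponents0 m : pe 0 m <-> P m.
Proof.
split=> [[s [p [_ Pp ->]]]|Pm]; first by rewrite big_ord0 add0r.
by exists (fun=> 0), m; split=> // [[]//|]; rewrite big_ord0 add0r.
Qed.

Lemma power_exponentsS j m :
  pe j.+1 m <-> exists x y, [/\ P x, x != 0, pe j y & m = x + y].
Proof.
split=> [[s [p [Ps Pp ->]]]|[x [y [Px x0 [s [p [Ps Pp ->]]] ->]]]].
  have [P0s s0] := Ps ord0.
  exists (s ord0), (\sum_(i < j) s (lift ord0 i) + p); split=> //.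
    by exists (s \o lift ord0), p; split=> // i; apply: Ps.
  by rewrite big_ord_recl addrA.
exists (fun i => if unlift ord0 i is Some i' then s i' else x), p; split=> //.
  by move=> i; case: unliftP => [i'|] _.
rewrite big_ord_recl unlift_none addrA.
by under [in RHS]eq_bigr do rewrite liftK.
Qed.

Lemma power_exponents_sub j m : pe j m -> P m.
Proof.
elim: j m => [|j IH] m; first by move/power_exponents0.
by move=> /power_exponentsS[x [y [Px _ /IH Py ->]]]; apply: PD.
Qed.

Lemma power_exponentsW j m : pe j.+1 m -> pe j m.
Proof.
elim: j m => [|j IH] m; first by move/power_exponents_sub/power_exponents0.
move=> /power_exponentsS[x [y [Px x0 /IH py ->]]].
by apply/power_exponentsS; exists x, y.
Qed.

Lemma power_exponents_le i j m : (i <= j)%N -> pe j m -> pe i m.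
Proof.
move=> /subnK <-; elim: (_ - _)%N => // l IH.
by rewrite addSn => /power_exponentsW.
Qed.

Lemma power_exponentsD i j x y : pe i x -> pe j y -> pe (i + j) (x + y).
Proof.
move=> px py; elim: i x px => [|i IH] x.
  move=> /power_exponents0 Px; rewrite add0n.
  elim: j y py => [|j IH] y; last first.
    move=> /power_exponentsS[z [y' [Pz z0 /IH py ->]]].
    by apply/power_exponentsS; exists z, (x + y'); split=> //; rewrite addrCA.
  by move/power_exponents0=> Py; apply/power_exponents0; exact: PD.
move=> /power_exponentsS[z [x' [Pz z0 /IH px ->]]].
by apply/power_exponentsS; exists z, (x' + y); split=> //; rewrite addrA.
Qed.

Lemma power_exponents1 x : P x -> x != 0 -> pe 1 x.
Proof.
move=> Px x0; apply/power_exponentsS; exists x, 0; split=> //.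
  exact/power_exponents0.
by rewrite addr0.
Qed.

Lemma power_exponents_0 j : pe j 0 -> j = 0%N.
Proof.
case: j => // j /power_exponentsS[x [y [Px x0 /power_exponents_sub Py]]].
move=> /eqP; rewrite eq_sym addrC addr_eq0 => /eqP yx.
by move: x0; rewrite (unitP Px) ?eqxx // -yx.
Qed.

Section Generators.
Variables (r : nat) (e : 'I_r -> T).
Hypothesis PE : P = [set \sum_(i < r) e i *+ c i | c in [set: 'I_r -> nat]].

(** The list of generators may contain 0, whose multiplicity contributes nothing to the length of a
    factorization. *)
Let w (c : 'I_r -> nat) := (\sum_(i < r | e i != 0%R) c i)%N.

Lemma generatorP i : P (e i).
Proof.
rewrite PE; exists (fun j => (j == i) : nat) => //.
by rewrite (bigD1 i) //= eqxx big1 ?addr0 // => j /negbTE ->.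
Qed.

Lemma power_exponents_comb c : pe (w c) (\sum_(i < r) e i *+ c i).
Proof.
rewrite /w big_mkcond /=.
apply: (big_ind2 (fun n x => pe n x)); first exact/power_exponents0.
  by move=> *; apply: power_exponentsD.
move=> i _; case: eqP => [->|/eqP e0]; first by rewrite mul0rn; apply/power_exponents0.
elim: (c i) => [|n IH]; first exact/power_exponents0.
rewrite mulrS -add1n; apply: power_exponentsD => //.
by apply: power_exponents1 => //; apply: generatorP.
Qed.

Lemma comb_power_exponents j m :
  pe j m -> exists2 c, m = \sum_(i < r) e i *+ c i & (j <= w c)%N.
Proof.
elim: j m => [|j IH] m.
  by move/power_exponents0; rewrite PE => -[c _ <-]; exists c.
move=> /power_exponentsS[x [y [+ x0 /IH[c -> jc] ->]]].
rewrite PE => -[d _ dE].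
exists (fun i => d i + c i)%N.
  by rewrite -dE -big_split; apply: eq_bigr => i _; rewrite mulrnDr.
rewrite /w big_split /= -add1n leq_add // lt0n; apply: contraNN x0.
rewrite sum_nat_eq0 -dE => /forallP d0; apply/eqP; apply: big1 => i _.
case: (eqVneq (e i) 0) => [->|ei]; first by rewrite mul0rn.
by move: (d0 i); rewrite ei /= => /eqP ->.
Qed.

(** Otherwise [m] has combinations of ever greater length. Dickson's lemma finds two of them with
    one below the other; their difference sums to 0 and involves a nonzero generator [e t], so
    [- e t] lies in [P], against the triviality of units. *)
Lemma power_exponents_bounded_gen m : exists N, ~ pe N m.
Proof.
apply/not_existsP => /= H.
have {}H N : exists c, m = \sum_(i < r) e i *+ c i /\ (N <= w c)%N.
  by have /contrapT /comb_power_exponents[c] := H N; exists c.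
have /choice[c cP] := H.
(* Each combination is chosen longer than the one before it. *)
pose u := fix F i := if i is j.+1 then c (w (F j)).+1 else c 0%N.
have um i : m = \sum_(t < r) e t *+ u i t by case: i => [|i] /=; apply: (proj1 (cP _)).
have uS i : (w (u i) < w (u i.+1))%N by apply: (proj2 (cP _)).
have ulen : {homo (w \o u) : i j / (i < j)%N}.
  by apply: homo_ltn => //; apply: ltn_trans.
have [i [j [ij uij]]] := dickson u.
have [t et lt_t] : exists2 t, e t != 0 & (u i t < u j t)%N.
  apply: contrapT => h; have := ulen _ _ ij; rewrite /= ltnNge => /negP[].
  rewrite /w leq_sum // => t et; rewrite leqNgt; apply/negP => lt_t.
  by apply: h; exists t.
have d0 : \sum_(s < r) e s *+ (u j s - u i s) = 0.
  apply: (addrI m); rewrite addr0 {1}(um i) -big_split (um j) /=.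
  by apply: eq_bigr => s _; rewrite -mulrnDr subnKC.
move: d0; rewrite (bigD1 t) //= -(subnK (_ : 1 <= u j t - u i t)%N) ?subn_gt0 //.
rewrite addn1 mulrS -addrA => /eqP; rewrite addrC addr_eq0 => /eqP h.
have /eqP[] := et; apply: unitP; first exact: generatorP.
have PM x n : P x -> P (x *+ n).
  by move=> Px; elim: n => [|n IH]; rewrite ?mulr0n // mulrS; apply: PD.
rewrite -h; apply: PD; first by apply: PM; apply: generatorP.
apply: (big_ind P) => // s _; apply: PM; exact: generatorP.
Qed.

Lemma power_exponents_cofinite_gen N : finite_set (P `\` pe N).
Proof.
pose h (c : {ffun 'I_r -> 'I_N.+1}) := \sum_(i < r) e i *+ c i.
apply: (@sub_finite_set _ _ [set h c | c in [set: {ffun 'I_r -> 'I_N.+1}]]); last first.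
  by apply: finite_image.
move=> x [+ xN]; rewrite {1}PE => -[c _ cE].
have wc : (w c < N)%N.
  rewrite ltnNge; apply/negP => le; apply: xN; apply: power_exponents_le le _.
  by rewrite -cE; apply: power_exponents_comb.
(* The length bounds only the multiplicities of nonzero generators; the others are reset to 0
   without changing the sum. *)
exists [ffun i => if e i == 0 then ord0 else inord (c i)] => //.
rewrite -cE; apply: eq_bigr => i _; rewrite ffunE; case: eqP => [->|/eqP ei].
  by rewrite !mul0rn.
rewrite inordK // ltnS (leq_trans _ (ltnW wc)) //.
by rewrite /w (bigD1 i) //= leq_addr.
Qed.

End Generators.

(** The degree of [m] is the last [j] with z^m in the j-th power of the monomial ideal, so adic
    closeness is a condition on degrees. Off [P] its values are arbitrary, except that 0 has degree
    0. *)
Lemma degree_exists : exists deg : T -> nat, degree P deg /\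
  forall m j, pe j m <-> P m /\ (j <= deg m)%N.
Proof.
have [r [e PE]] := finP.
have /choice[deg degP] : forall m, exists d, P m -> forall j, pe j m <-> (j <= d)%N.
  move=> m; case: (pselect (P m)) => [Pm|]; last by exists 0%N.
  pose A := fun j => ~~ `[< pe j m >].
  have exA : exists j, A j.
    have [N HN] := power_exponents_bounded_gen PE m.
    by exists N; apply/asboolPn.
  have := ex_minnP exA => -[[|d] /asboolPn nd min].
    by case: nd; apply/power_exponents0.
  exists d => _ j; split=> [pj|le_jd].
    rewrite -ltnS ltnNge; apply/negP => le; apply: nd.
    exact: power_exponents_le le pj.
  apply: contrapT => /asboolPn /min; by rewrite ltnNge le_jd.
have degE m j : pe j m <-> P m /\ (j <= deg m)%N.
  split=> [pm|[Pm /degP]]; last by apply.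
  have Pm := power_exponents_sub pm; split=> //; exact/degP.
exists deg; split=> //; split=> // [|x Px x0|x y Px Py|N].
- by apply/eqP; rewrite -leqn0 (power_exponents_0 (j := deg 0)) //; apply/degE.
- by have /degE[] := power_exponents1 Px x0.
- have /degE[_ //] : pe (deg x + deg y) (x + y).
  by apply: power_exponentsD; apply/degE.
apply: sub_finite_set (power_exponents_cofinite_gen PE N.+1) => m [Pm le].
by split=> // /degE[_]; rewrite ltnNge le.
Qed.

End Degree.

(** * Trees as sets of words *)

Section Forests.
Variables (T : zmodType) (D : set T) (S : {fset T}).

(* A labelled tree in which siblings carry distinct labels is encoded by the
   set of its non-root vertices, a vertex being identified with the word of
   labels met on the way down to it from the root, the root excluded.  The
   label of the root is not part of the code. *)

Definition children (Phi : {fset seq T}) (s : seq T) : {fset T} :=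
  [fset last 0 w | w in Phi & w == rcons s (last 0 w)]%fset.

Lemma in_children Phi s x : (x \in children Phi s) = (rcons s x \in Phi).
Proof.
apply/imfsetP/idP => [[w /= /andP[Pw /eqP wE] ->]|Px]; first by rewrite -wE.
by exists (rcons s x); rewrite ?last_rcons //= inE Px last_rcons eqxx.
Qed.

(** The local condition at one vertex. Distinctness of sibling labels needs no clause, since the
    children are given as a set of labels. *)
Definition branching (m : T) (C : {fset T}) : Prop :=
  C = fset0 /\ m \in S \/
  [/\ C != fset0, #|` C| != 1%N & m = \sum_(c <- C) c].

(** Nothing is demanded at the empty word: words of length one are the roots of the forest. [tree]
    puts a common root above them, and [forests] constrains only their labels and sum. *)
Definition forest (Phi : {fset seq T}) : Prop :=
  [::] \notin Phi /\ forall s x, rcons s x \in Phi ->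
    [/\ s = [::] \/ s \in Phi, D x & branching x (children Phi (rcons s x))].

Definition tree (m : T) : set {fset seq T} :=
  [set Phi | forest Phi /\ branching m (children Phi [::])].

Definition forests (A : {fset T}) (y : T) : set {fset seq T} :=
  [set Phi | [/\ forest Phi, (children Phi [::] `<=` A)%fset &
    \sum_(c <- children Phi [::]) c = y]].

Definition forest_nonleaves (Phi : {fset seq T}) : nat :=
  \sum_(s <- Phi) (children Phi s != fset0).

(** The root is the empty word and not an element of [Phi]; for a forest [Phi], it is a leaf exactly
    when [Phi] is empty. *)
Definition tree_nonleaves (Phi : {fset seq T}) : nat :=
  (Phi != fset0) + forest_nonleaves Phi.

Lemma forest_prefix Phi s t : forest Phi -> s ++ t \in Phi -> s = [::] \/ s \in Phi.
Proof.
move=> [_ fP]; elim/last_ind: t => [|t x IH]; first by rewrite cats0; right.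
by rewrite -rcons_cat => /fP[[h _ _|/IH //]]; left; case: (s) h.
Qed.

Lemma forest_head Phi x s : forest Phi -> x :: s \in Phi -> [:: x] \in Phi.
Proof. by move=> fP; rewrite -cat1s => /(forest_prefix fP)[]. Qed.

Lemma forest_children Phi s : forest Phi -> [set` children Phi s] `<=` D.
Proof. by move=> [_ fP] x /=; rewrite in_children => /fP[]. Qed.

Lemma forest_eq0 Phi : forest Phi -> (children Phi [::] == fset0) = (Phi == fset0).
Proof.
move=> fP; apply/eqP/eqP => [C0|->].
  apply/fsetP => -[|x s]; rewrite inE; first by apply/negbTE/(proj1 fP).
  apply/negP => /(forest_head fP); rewrite -[[:: x]]/(rcons [::] x) -in_children.
  by rewrite C0 inE.
by apply/fsetP => x; rewrite in_children !inE.
Qed.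

Lemma forest0 : forest fset0.
Proof. by split; rewrite ?inE // => s x; rewrite inE. Qed.

Lemma forests_set0 y : forests fset0 y = [set Phi | Phi = fset0 /\ y = 0].
Proof.
apply/seteqP; split=> Phi /=.
  move=> [fP]; rewrite fsubset0 forest_eq0 // => /eqP P0.
  have /eqP : children Phi [::] == fset0 by rewrite forest_eq0 // P0.
  by move=> ->; rewrite P0 big_seq_fset0 => <-.
move=> [-> ->]; have /eqP : children fset0 [::] == fset0.
  by rewrite forest_eq0 //; apply: forest0.
by move=> c0; split; rewrite ?c0 ?fsubset_refl ?big_seq_fset0 //; apply: forest0.
Qed.

(** Plants the tree with root label [x] and code [Psi] beside the forest [Phi]. When [Phi] has no
    root [x], [subforest] and [prune] recover the two pieces. *)
Definition graft (x : T) (Psi Phi : {fset seq T}) : {fset seq T} :=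
  ([:: x] |` ([fset x :: s | s in Psi] `|` Phi))%fset.

Definition subforest (x : T) (Phi : {fset seq T}) : {fset seq T} :=
  [fset behead w | w in Phi & (w == x :: behead w) && (behead w != [::])]%fset.

Lemma in_graft_cons x Psi Phi y s : (y :: s \in graft x Psi Phi) =
  (y == x) && ((s == [::]) || (s \in Psi)) || (y :: s \in Phi).
Proof.
rewrite !inE orbA eqseq_cons; congr (_ || _).
rewrite andb_orr; congr (_ || _).
apply/imfsetP/andP => [[t /= tP [-> ->]]|[/eqP-> sP]]; first by rewrite eqxx.
by exists s.
Qed.

Lemma nil_graft x Psi Phi : ([::] \in graft x Psi Phi) = ([::] \in Phi).
Proof.
rewrite !inE /= orbC; case: (_ \in Phi) => //=.
by apply/imfsetP => -[].
Qed.

Lemma in_subforest x Phi s :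
  (s \in subforest x Phi) = (s != [::]) && (x :: s \in Phi).
Proof.
apply/imfsetP/andP => [[w /= /and3P[Pw /eqP wE w0] ->]|[s0 sP]].
  by rewrite -wE.
by exists (x :: s) => //=; rewrite inE sP eqxx.
Qed.

Section Graft.
Variables (x : T) (Psi Phi : {fset seq T}).
Hypotheses (Phi_nil : [::] \notin Phi) (Phi_x : forall s, x :: s \notin Phi).
Hypothesis Psi_nil : [::] \notin Psi.

Lemma children_graft_nil :
  children (graft x Psi Phi) [::] = (x |` children Phi [::])%fset.
Proof. by apply/fsetP => y; rewrite in_fset1U !in_children in_graft_cons eqxx andbT. Qed.

Lemma children_graft_cons s : children (graft x Psi Phi) (x :: s) = children Psi s.
Proof.
apply/fsetP => y; rewrite !in_children rcons_cons in_graft_cons eqxx /=.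
rewrite (negbTE (Phi_x _)) orbF; by case: s.
Qed.

Lemma children_graft_neq y s : y != x ->
  children (graft x Psi Phi) (y :: s) = children Phi (y :: s).
Proof.
by move=> yx; apply/fsetP => z; rewrite !in_children in_graft_cons (negbTE yx).
Qed.

Lemma subforest_graft : subforest x (graft x Psi Phi) = Psi.
Proof.
apply/fsetP => s; rewrite in_subforest in_graft_cons eqxx (negbTE (Phi_x _)) orbF.
by case: s => //=; rewrite (negbTE Psi_nil).
Qed.


Lemma graft_perm :
  perm_eq (graft x Psi Phi) ([:: x] :: [seq x :: s | s <- Psi] ++ Phi).
Proof.
apply: uniq_perm; first exact: fset_uniq.
  rewrite /= mem_cat negb_or Phi_x andbT cat_uniq fset_uniq andbT.
  rewrite map_inj_uniq ?fset_uniq => [|? ? []//]; apply/andP; split.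
    by apply/mapP => -[s sP [s0]]; move: sP; rewrite -s0 (negbTE Psi_nil).
  rewrite /=; apply/hasPn => w wP; apply/mapP => -[s _ wE].
  by move: wP; rewrite wE (negbTE (Phi_x _)).
move=> w; rewrite !inE mem_cat; congr (_ || (_ || _)).
by apply/imfsetP/mapP => -[s sP ->]; exists s.
Qed.

(** The root of the planted tree becomes the vertex [[:: x]] of the new forest, so it must now be
    counted: hence [tree_nonleaves] for [Psi]. *)
Lemma graft_nonleaves : forest Psi ->
  forest_nonleaves (graft x Psi Phi) = (tree_nonleaves Psi + forest_nonleaves Phi)%N.
Proof.
move=> fPsi; rewrite /tree_nonleaves /forest_nonleaves.
rewrite (perm_big _ graft_perm) big_cons big_cat big_map /=.
rewrite children_graft_cons forest_eq0 // addnA; congr (_ + _ + _)%N.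
  by apply: eq_bigr => s _; rewrite children_graft_cons.
apply: eq_big_seq => -[|y s] wP; first by move: Phi_nil; rewrite wP.
rewrite children_graft_neq //; apply: contraTneq wP => ->; exact: Phi_x.
Qed.

End Graft.

Lemma forest_notin Phi x : forest Phi -> x \notin children Phi [::] ->
  forall s, x :: s \notin Phi.
Proof.
by move=> fP; rewrite in_children => xP s; apply: contra xP => /(forest_head fP).
Qed.

Lemma graft_forest x Psi Phi : D x -> tree x Psi -> forest Phi ->
  x \notin children Phi [::] -> forest (graft x Psi Phi).
Proof.
move=> Dx [fPsi bPsi] fPhi /(forest_notin fPhi) xP.
split; first by rewrite nil_graft; case: fPhi.
have nPsi := proj1 fPsi.
case=> [|z s] y.
  rewrite in_graft_cons eqxx andbT /= => /orP[/eqP->|yP].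
    by rewrite children_graft_cons //; split=> //; left.
  rewrite children_graft_neq; last by apply: contraTneq yP => ->.
  by have [_ Dy by_] := proj2 fPhi [::] y yP; split=> //; left.
rewrite rcons_cons in_graft_cons => /orP[/andP[/eqP->]|zP].
  have -> : (rcons s y == [::]) = false by case: (s).
  move=> /= /(proj2 fPsi)[sP Dy bry]; rewrite children_graft_cons //.
  by split=> //; right; rewrite in_graft_cons eqxx; case: sP => ->; rewrite ?orbT.
have zx : z != x by apply: contraTneq zP => ->.
have [sP Dy bry] := proj2 fPhi (z :: s) y zP.
rewrite children_graft_neq //; split=> //; right.
by rewrite in_graft_cons; case: sP => // ->; rewrite orbT.
Qed.

Lemma subforest_tree x Phi : forest Phi -> x \in children Phi [::] ->
  tree x (subforest x Phi).
Proof.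
move=> fP; rewrite in_children /= => xP.
have chE s : children (subforest x Phi) s = children Phi (x :: s).
  by apply/fsetP => y; rewrite !in_children in_subforest; case: s.
split.
  split=> [|s y]; first by rewrite in_subforest.
  rewrite chE in_subforest => /andP[_ /= syP].
  have [sP Dy bry] := proj2 fP (x :: s) y syP; split=> //.
  by case: (s) sP => [|z s' [//|sP]]; [left|right; rewrite in_subforest].
by rewrite chE; have [] := proj2 fP [::] x xP.
Qed.

Definition prune (x : T) (Phi : {fset seq T}) : {fset seq T} :=
  [fset w in Phi | head 0 w != x]%fset.

Lemma in_prune_cons x Phi y s : (y :: s \in prune x Phi) = (y :: s \in Phi) && (y != x).
Proof. by rewrite !inE. Qed.

Lemma nil_prune x Phi : [::] \notin Phi -> [::] \notin prune x Phi.
Proof. by apply: contra; rewrite !inE => /andP[]. Qed.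

Lemma prune_forest x Phi : forest Phi -> forest (prune x Phi).
Proof.
move=> fP; split; first by apply: nil_prune; case: fP.
have chE y s : y != x -> children (prune x Phi) (y :: s) = children Phi (y :: s).
  by move=> yx; apply/fsetP => z; rewrite !in_children rcons_cons in_prune_cons yx andbT.
case=> [|z s] y.
  rewrite in_prune_cons => /andP[yP yx]; rewrite chE //.
  by have [_ Dy br] := proj2 fP [::] y yP; split=> //; left.
rewrite rcons_cons in_prune_cons => /andP[zP zx].
have [[//|sP] Dy br] := proj2 fP (z :: s) y zP.
by rewrite chE //; split=> //; right; rewrite in_prune_cons sP.
Qed.

Lemma children_prune x Phi : children (prune x Phi) [::] = (children Phi [::] `\ x)%fset.
Proof. by apply/fsetP => y; rewrite in_fsetD1 !in_children in_prune_cons andbC. Qed.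

Lemma graft_prune x Phi : forest Phi -> x \in children Phi [::] ->
  graft x (subforest x Phi) (prune x Phi) = Phi.
Proof.
move=> fP; rewrite in_children /= => xP; apply/fsetP => -[|y s].
  rewrite nil_graft; have n := proj1 fP.
  by rewrite (negbTE n) (negbTE (nil_prune x n)).
rewrite in_graft_cons in_prune_cons in_subforest; case: (eqVneq y x) => [->|_].
  by rewrite andbF orbF; case: s => [|z s] //=; rewrite xP.
by rewrite andbT.
Qed.

Lemma prune_graft x Psi Phi : [::] \notin Phi -> (forall s, x :: s \notin Phi) ->
  prune x (graft x Psi Phi) = Phi.
Proof.
move=> nP xP; apply/fsetP => -[|y s].
  have := nil_prune x; move=> /(_ (graft x Psi Phi)); rewrite nil_graft => /(_ nP).
  by rewrite (negbTE nP) => /negbTE.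
rewrite in_prune_cons in_graft_cons; case: (eqVneq y x) => [->|_] /=.
  by rewrite andbF (negbTE (xP _)).
by rewrite andbT.
Qed.

Lemma graft_bij x A y : D x -> x \notin A ->
  set_bij (tree x `*` forests A (y - x))
    (forests (x |` A)%fset y `&` [set Phi | x \in children Phi [::]])
    (fun p => graft x p.1 p.2).
Proof.
move=> Dx xA.
have xch Phi z : forests A z Phi -> x \notin children Phi [::].
  by move=> [_ /fsubsetP sub _]; apply: contra xA; apply: sub.
split.
- move=> [Psi Phi] /= [tPsi fsPhi]; have [fPhi sub sumPhi] := fsPhi.
  have xPhi := xch _ _ fsPhi.
  rewrite children_graft_nil; split; last by rewrite /= in_fset1U eqxx.
  split; first exact: graft_forest.
    by rewrite children_graft_nil; apply: fsetUS.
  by rewrite children_graft_nil big_fsetU1 //= sumPhi addrC subrK.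
- move=> [Psi Phi] [Psi' Phi'] /set_mem[/= [fPsi _] fsPhi] /set_mem[/= [fPsi' _] fsPhi'] eqg.
  have [fPhi _ _] := fsPhi; have [fPhi' _ _] := fsPhi'.
  have xPhi := forest_notin fPhi (xch _ _ fsPhi).
  have xPhi' := forest_notin fPhi' (xch _ _ fsPhi').
  congr pair.
    rewrite -(subforest_graft xPhi (proj1 fPsi)) eqg subforest_graft //.
    exact: (proj1 fPsi').
  rewrite -(prune_graft Psi (proj1 fPhi) xPhi) eqg prune_graft //.
  exact: (proj1 fPhi').
- move=> Phi [[fPhi sub sumPhi] /= xPhi].
  exists (subforest x Phi, prune x Phi); last by rewrite /= graft_prune.
  split=> /=; first exact: subforest_tree.
  split; first exact: prune_forest.
    rewrite children_prune; apply/fsubsetP => z; rewrite in_fsetD1 => /andP[zx /(fsubsetP sub)].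
    by rewrite in_fset1U (negbTE zx).
  rewrite children_prune -sumPhi [in RHS](big_fsetD1 x) //=.
  by rewrite [x + _]addrC addrK.
Qed.

End Forests.

(** * Finiteness and signed counts of forests *)

Section GradedForests.
Variables (T : zmodType) (P D : set T) (S : {fset T}) (deg : T -> nat).
Hypothesis degP : degree P deg.

Let P0 := degree_in0 degP.
Let PD := degree_inD degP.
Let deg0 := degree0 degP.
Let deg_gt0 := degree_gt0 degP.
Let degD := degreeD degP.
Let finite_ball := degree_ball degP.

Hypotheses (DP : D `<=` P) (D0 : forall x, D x -> x != 0).

Lemma sum_in (A : {fset T}) : [set` A] `<=` P ->
  P (\sum_(x <- A) x) /\ (\sum_(x <- A) deg x <= deg (\sum_(x <- A) x))%N.
Proof.
move=> AP; rewrite big_seq [X in (X <= _)%N]big_seq.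
apply: (big_ind2 (fun s n => P s /\ (n <= deg s)%N)) => [||x xA].
- by rewrite deg0.
- move=> x m y n [Px mx] [Py ny]; split; first exact: PD.
  exact: leq_trans (leq_add mx ny) (degD Px Py).
- by split=> //; apply: AP.
Qed.

(** A set containing [x] but not a singleton has a second element, whose degree is positive. *)
Lemma deg_child (A : {fset T}) x : [set` A] `<=` D -> x \in A ->
  (#|` A| != 1)%N -> (deg x < deg (\sum_(y <- A) y))%N.
Proof.
move=> AD xA A1.
have [_] := sum_in (fun y yA => DP (AD y yA)); apply: leq_trans.
rewrite (big_fsetD1 x) //= -addn1 leq_add2l.
have [B0|[y yB]] := fset_0Vmem (A `\ x)%fset.
  by move: A1; rewrite (cardfsD1 x) xA B0 cardfs0.
rewrite (big_fsetD1 y) //= addn_gt0.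
have yA : y \in A by move: yB; rewrite in_fsetD1 => /andP[].
by rewrite deg_gt0 //; [apply/DP/AD|apply/D0/AD].
Qed.

Lemma sum_eq0 (A : {fset T}) : [set` A] `<=` D ->
  \sum_(y <- A) y = 0 -> A = fset0.
Proof.
move=> AD sA; have [//|[y yA]] := fset_0Vmem A.
have [_] := sum_in (fun y yA => DP (AD y yA)).
rewrite sA deg0 (big_fsetD1 y) //= leqn0 addn_eq0 => /andP[+ _].
by rewrite -leqn0 leqNgt deg_gt0 //; [apply/DP/AD|apply/D0/AD].
Qed.

Lemma finite_words (B : set T) N : finite_set B ->
  finite_set [set w : seq T | (size w <= N)%N /\ forall x, x \in w -> B x].
Proof.
move=> finB; elim: N => [|N IH].
  by apply: (sub_finite_set _ (finite_set1 [::])) => w /= [+ _]; case: w.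
set W := (X in finite_set X) in IH.
apply: (@sub_finite_set _ _ ([::] |` [set p.1 :: p.2 | p in B `*` W])).
  move=> [|x w] /= [sw wB]; [by left|right].
  exists (x, w) => //; split=> /=; first by apply: wB; rewrite inE eqxx.
  by split=> // y yw; apply: wB; rewrite inE yw orbT.
rewrite finite_setU; split; first exact: finite_set1.
exact/finite_image/finite_setX.
Qed.

Lemma deg_parent Phi s x : forest D S Phi -> s \in Phi -> rcons s x \in Phi ->
  (deg x < deg (last 0%R s))%N.
Proof.
move=> fP; case/lastP: s => [|s y] sP sxP; first by have := proj1 fP; rewrite sP.
have [_ _ [[C0 _]|[C0 C1 yE]]] := proj2 fP s y sP.
  by move: sxP; rewrite -in_children C0 inE.
rewrite last_rcons yE; apply: deg_child => //; first exact: (forest_children fP).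
by rewrite in_children.
Qed.

(** Labels lose degree on the way down, so the length of a word plus the degree of its last letter
    never grows along a branch. At a root it is at most 1 + N, which leaves finitely many words. *)
Lemma finite_forests (A : {fset T}) : [set` A] `<=` D ->
  finite_set [set Phi | forest D S Phi /\ (children Phi [::] `<=` A)%fset].
Proof.
move=> AD; pose N := \max_(x <- A) deg x.
have finW := finite_words N.+1 (finite_ball N).
apply: (@sub_finite_set _ _ [set` fpowerset (fset_set
  [set w : seq T | (size w <= N.+1)%N /\
     forall x, x \in w -> [set x | P x /\ (deg x <= N)%N] x])]); last exact: finite_fset.
move=> Phi [fP /fsubsetP rootsA] /=; rewrite fpowersetE; apply/fsubsetP => w wP.
rewrite in_fset_set // inE /=.
suff : forall w, w \in Phi -> (size w + deg (last 0%R w) <= N.+1)%N /\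
    forall x, x \in w -> P x /\ (deg x <= N)%N.
  move=> /(_ w wP)[sw wN]; split=> //; apply: leq_trans sw; exact: leq_addr.
elim/last_ind => {w wP} [|s x IH] sxP; first by have := proj1 fP; rewrite sxP.
rewrite size_rcons last_rcons; have [sP Dx _] := proj2 fP s x sxP.
have Px := DP Dx.
have bound : (size s + deg x <= N)%N.
  case: sP => [s0|/[dup] sP /IH[sN _]].
    rewrite s0 add0n; have xA : x \in A by apply: rootsA; rewrite in_children -s0.
    by rewrite /N (big_fsetD1 x) //= leq_maxl.
  rewrite -ltnS; apply: leq_trans sN; rewrite -addnS leq_add2l.
  exact: (deg_parent fP).
split; first by rewrite addSn ltnS.
move=> y; rewrite mem_rcons inE => /orP[/eqP->|ys].
  by split=> //; apply: leq_trans bound; exact: leq_addl.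
case: sP => [s0|/IH[_]]; last exact.
by rewrite s0 in ys.
Qed.

(** Since [y] is not 0 the forest is not empty, and since [y] is not in [A] it is not a single tree;
    the roots of any other forest of sum [y] have degree below that of [y]. The code [fset0], a lone
    leaf, has no forest under its root. *)
Lemma forests_tree (A : {fset T}) y : [set` A] `<=` D -> y != 0 -> y \notin A ->
  (forall x, D x -> (deg x < deg y)%N -> x \in A) ->
  forests D S A y = tree D S y `\ fset0.
Proof.
move=> AD y0 yA ballA; apply/seteqP; split=> Phi /=.
  move=> [fP sub sumP].
  have P_neq0 : Phi <> fset0.
    move=> P0'; move: sumP y0; have /eqP -> : children Phi [::] == fset0.
      by rewrite (forest_eq0 fP) P0'.
    by rewrite big_seq_fset0 => <-; rewrite eqxx.
  split=> //; split=> //; right; split=> //.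
    by rewrite (forest_eq0 fP); apply/eqP.
  apply: contra yA => /cardfs1P[x chE].
  by apply: (fsubsetP sub); rewrite -sumP chE big_seq_fset1 fset11.
move=> [[fP br] /eqP Phi0]; case: br => [[C0 _]|[C0 C1 yE]].
  by move: Phi0; rewrite -(forest_eq0 fP) C0 eqxx.
split=> //; apply/fsubsetP => x xC; apply: ballA.
  exact: (forest_children fP xC).
by rewrite yE; apply: deg_child => //; apply: (forest_children fP).
Qed.

Lemma finite_tree y : finite_set (tree D S y).
Proof.
pose A := fset_set [set x | D x /\ (deg x < deg y)%N].
have finA : finite_set [set x | D x /\ (deg x < deg y)%N].
  apply: sub_finite_set (finite_ball (deg y)) => x [/DP Dx lt].
  by split=> //; apply: ltnW.
have AD : [set` A] `<=` D by move=> x /=; rewrite in_fset_set // inE => -[].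
apply: sub_finite_set (finite_forests AD) => Phi [fP br].
split=> //; apply/fsubsetP => x xC; rewrite in_fset_set // inE /=.
split; first exact: (forest_children fP xC).
case: br => [[C0 _]|[C0 C1 ->]]; first by rewrite C0 inE in xC.
by apply: deg_child => //; apply: (forest_children fP).
Qed.

Variable k : fieldType.

(** [tree_sum m] and [forest_sum A y] are a_m and E_A(y), computed on codes. *)
Definition tree_sum (m : T) : k :=
  \sum_(Phi \in tree D S m) (-1 : k) ^+ tree_nonleaves Phi.

Definition forest_sum (A : {fset T}) (y : T) : k :=
  \sum_(Phi \in forests D S A y) (-1 : k) ^+ forest_nonleaves Phi.

Lemma finite_forests_sum (A : {fset T}) y : [set` A] `<=` D ->
  finite_set (forests D S A y).
Proof. by move=> /finite_forests; apply: sub_finite_set => Phi []. Qed.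

Lemma forest_nonleaves0 : forest_nonleaves (fset0 : {fset seq T}) = 0%N.
Proof. exact: big_seq_fset0. Qed.

Lemma forest_sum_set0 y : forest_sum fset0 y = zmon 1 0 y.
Proof.
rewrite /forest_sum /zmon forests_set0; case: eqP => [->|y0].
  rewrite (_ : [set Phi | _] = [set fset0]); last by apply/seteqP; split=> Phi [].
  by rewrite fsbig_set1 forest_nonleaves0.
by rewrite fsbig1 // => Phi [_ /y0].
Qed.

Lemma forest_sum_add (A : {fset T}) x y : [set` A] `<=` D -> D x -> x \notin A ->
  forest_sum (x |` A)%fset y = forest_sum A y + tree_sum x * forest_sum A (y - x).
Proof.
move=> AD Dx xA.
have xAD : [set` (x |` A)%fset] `<=` D.
  by move=> z /=; rewrite in_fset1U => /orP[/eqP->|/AD].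
rewrite /forest_sum (fsbigID [set Phi | x \in children Phi [::]]); last exact: finite_forests_sum.
rewrite [RHS]addrC; congr (_ + _); last first.
  apply: eq_fsbigl; apply/seteqP; split=> Phi /=.
    move=> [[fP sub sumP] /negP xP]; split=> //; apply/fsubsetP => z zP.
    have := fsubsetP sub z zP; rewrite in_fset1U => /orP[/eqP zx|//].
    by rewrite -zx zP in xP.
  move=> [fP sub sumP]; split; last by apply/negP; apply: contra xA; apply: (fsubsetP sub).
  by split=> //; apply: fsubset_trans sub _; apply: fsubsetU1.
rewrite (reindex_fsbig _ _ _ _ (graft_bij S y Dx xA)).
rewrite /tree_sum mulr_fsuml.
under [RHS]eq_fsbigr do rewrite mulr_fsumr.
rewrite pair_fsbig; [|exact: finite_tree|exact: finite_forests_sum].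
apply: eq_fsbigr => -[Psi Phi] /set_mem[/= [fPsi _] [fPhi sub _]].
rewrite -exprD (graft_nonleaves _ _ _ fPsi) //; [by case: fPhi| |by case: fPsi].
by apply: (forest_notin fPhi); apply: contra xA; apply: (fsubsetP sub).
Qed.

Lemma forest_sum0 (A : {fset T}) : [set` A] `<=` D -> forest_sum A 0 = 1.
Proof.
move=> AD; rewrite /forest_sum (_ : forests D S A 0 = [set fset0]).
  by rewrite fsbig_set1 forest_nonleaves0.
apply/seteqP; split=> Phi /=.
  move=> [fP sub sumP]; apply/eqP; rewrite -(forest_eq0 fP); apply/eqP.
  by apply: sum_eq0 sumP; apply: forest_children fP.
move=> ->; have c0 : children (fset0 : {fset seq T}) [::] = fset0.
  by apply/eqP; rewrite (forest_eq0 (forest0 D S)).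
by split; rewrite ?c0 ?big_seq_fset0 //; apply: forest0.
Qed.

Lemma tree_nonleaves_neq0 (Phi : {fset seq T}) : Phi != fset0 ->
  (-1 : k) ^+ forest_nonleaves Phi = - (-1) ^+ tree_nonleaves Phi.
Proof. by move=> P_neq0; rewrite /tree_nonleaves P_neq0 exprS mulN1r opprK. Qed.

Lemma tree0 y : tree D S y fset0 <-> y \in S.
Proof.
split=> [[_ [[//]|[]]]|yS].
  by rewrite (forest_eq0 (forest0 D S)) eqxx.
split; first exact: forest0.
by left; split=> //; apply/eqP; rewrite (forest_eq0 (forest0 D S)).
Qed.

Lemma tree_notin y : y \notin S -> tree D S y `\ fset0 = tree D S y.
Proof.
move=> yS; apply/seteqP; split=> [Phi []//|Phi tP]; split=> // Phi0.
by move: yS; rewrite Phi0 in tP; rewrite (proj1 (tree0 y) tP).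
Qed.

(** Splitting off the label [y] gives E_A(y) = E_{A - y}(y) + a_y. The first term counts the trees
    with root [y] other than the lone leaf, with the root removed; losing that one non-leaf flips
    the sign, so everything cancels except the lone leaf. *)
Lemma forest_sum_root (A : {fset T}) y : [set` A] `<=` D -> D y ->
  (forall x, D x -> (deg x <= deg y)%N -> x \in A) -> forest_sum A y = (y \in S)%:R.
Proof.
move=> AD Dy ballA; have yA : y \in A by exact: ballA.
have AyD : [set` (A `\ y)%fset] `<=` D.
  by move=> z /=; rewrite in_fsetD1 => /andP[_ /AD].
rewrite -(fsetD1K yA) forest_sum_add //; last by rewrite in_fsetD1 eqxx.
rewrite subrr forest_sum0 // mulr1 /forest_sum forests_tree //; last 3 first.
- exact: D0.
- by rewrite in_fsetD1 eqxx.
- move=> x Dx lt; rewrite in_fsetD1 ballA ?(ltnW lt) // andbT.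
  by apply: contraTneq lt => ->; rewrite ltnn.
rewrite (eq_fsbigr (fun Phi => - (-1) ^+ tree_nonleaves Phi)); last first.
  by move=> Phi /set_mem[_ /= /eqP/tree_nonleaves_neq0].
rewrite /tree_sum; case: (boolP (y \in S)) => yS.
  rewrite (fsbigD1 fset0 (tree D S y)); [|exact: finite_tree|exact/tree0].
  rewrite /tree_nonleaves eqxx forest_nonleaves0 expr0 addrCA -/tree_nonleaves.
  rewrite -fsbig_split; last first.
    by apply: sub_finite_set (finite_tree y) => Phi [].
  by rewrite fsbig1 ?addr0 // => Phi _; rewrite /= addNr.
rewrite tree_notin //.
rewrite -fsbig_split; last exact: finite_tree.
by rewrite fsbig1 // => Phi _; rewrite /= addNr.
Qed.

(** Here [y] is no admissible label, so nothing cancels; the exponent drops by one for the removed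
    root, a non-leaf because [y] is not in [S]. *)
Lemma forest_sum_curve (A : {fset T}) y : [set` A] `<=` D -> y != 0 -> ~ D y ->
  y \notin S -> (forall x, D x -> (deg x <= deg y)%N -> x \in A) ->
  forest_sum A y = \sum_(Phi \in tree D S y) (-1 : k) ^+ (tree_nonleaves Phi).-1.
Proof.
move=> AD y0 nDy yS ballA; rewrite /forest_sum forests_tree //; last 2 first.
- by apply/negP => /AD.
- by move=> x Dx /ltnW; apply: ballA.
rewrite tree_notin //.
apply: eq_fsbigr => Phi /set_mem tP.
rewrite /tree_nonleaves (_ : Phi != fset0) //.
by apply: contraNneq yS => P_eq0; rewrite P_eq0 in tP; apply/tree0.
Qed.

End GradedForests.

(** * Labelled posets and words *)

Section Codings.
Variable T : zmodType.

Definition prefix_closed (Phi : {fset seq T}) : Prop :=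
  forall s x, rcons s x \in Phi -> s = [::] \/ s \in Phi.

(** An isomorphism of [G] with a set of words under the reversed prefix order: the root, being
    maximal, is the empty word, and [m] enters as its label through the default of [last]. *)
Record coding (G : ltree T) (m : T) (Phi : {fset seq T})
    (w : 'I_(Defs.tsize G) -> seq T) : Prop := Coding {
  coding_inj : injective w;
  coding_le : forall u v, tle u v = prefix (w v) (w u);
  coding_label : forall v, label v = last m (w v);
  coding_img : forall s, (exists v, w v = s) <-> s = [::] \/ s \in Phi;
  coding_nil : [::] \notin Phi;
  coding_closed : prefix_closed Phi
}.

Section Coding.
Variables (G : ltree T) (m : T) (Phi : {fset seq T}) (w : 'I_(Defs.tsize G) -> seq T).
Hypothesis wP : coding m Phi w.

(** Prefix-closedness supplies a vertex for every intermediate prefix, so a covering relation can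
    only append a single letter. *)
Lemma coding_predecessor v u :
  predecessor (@tle T G) v u = (w u == rcons (w v) (label u)).
Proof.
have [w_inj w_le w_lab w_img nPhi cl] := wP.
apply/and3P/eqP => [[uv le_vu /forallP btw]|wu]; last first.
  split.
  - by apply/eqP => uv; have := congr1 size wu; rewrite uv size_rcons => /n_Sn.
  - by rewrite w_le wu prefix_rcons.
  apply/forallP => z; apply/implyP; rewrite !w_le => /andP[/prefixP[t wut] /prefixP[t' wzt]].
  move: wut; rewrite wzt -catA wu -cats1 => /eqP.
  rewrite eqseq_cat // eqxx /= => /eqP.
  case: t' wzt => [|y t'] wzt /=; last first.
    move=> [yE]; case: t' wzt => // wzt _; apply/orP; left; apply/eqP/w_inj.
    by rewrite wzt wu -cats1 yE.
  by rewrite cats0 in wzt; rewrite (w_inj _ _ wzt) eqxx orbT.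
move: le_vu; rewrite w_le => /prefixP[t wut]; rewrite w_lab wut.
case/lastP: t wut => [|t x] wut.
  by rewrite cats0 in wut; rewrite (w_inj _ _ wut) eqxx in uv.
rewrite -rcons_cat last_rcons; congr rcons.
have uPhi : rcons (w v ++ t) x \in Phi.
  have /w_img[] : exists u', w u' = w u by exists u.
    by rewrite wut -rcons_cat; case: (_ ++ _).
  by rewrite wut rcons_cat.
have [z wz] : exists z, w z = w v ++ t by apply/w_img/(cl _ x).
have := btw z; rewrite !w_le wz prefix_prefix wut -rcons_cat prefix_rcons /=.
move=> /orP[] /eqP zE; last by rewrite -wz zE.
move/(congr1 size): wz; rewrite zE wut -rcons_cat size_rcons => /eqP.
by rewrite -[X in _ == X]addn0 -addn1 eqn_add2l.
Qed.

Lemma coding_root : exists r, w r = [::].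
Proof. by apply/(coding_img wP); left. Qed.


Lemma coding_in v : w v != [::] -> w v \in Phi.
Proof.
move=> /eqP wv; have /(coding_img wP)[|//] : exists u, w u = w v by exists v.
by move/wv.
Qed.

Lemma coding_parent v : w v != [::] -> exists u, w v = rcons (w u) (label v).
Proof.
move=> wv; have vPhi := coding_in wv; have lv := coding_label wP v.
case/lastP: (w v) wv vPhi lv => // s x _ vPhi; rewrite last_rcons => ->.
have /(coding_img wP)[u <-] := coding_closed wP vPhi.
by exists u.
Qed.

Lemma coding_maximal v : maximal (@tle T G) v = (w v == [::]).
Proof.
apply/forallP/eqP => [mv|wv u].
  have [r wr] := coding_root; have := mv r.
  by rewrite (coding_le wP) wr prefix0s /= => /eqP <-.
rewrite (coding_le wP) wv prefixs0; apply/implyP => /eqP wu.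
by apply/eqP/(coding_inj wP); rewrite wu.
Qed.

Lemma coding_children v :
  perm_eq [seq label u | u <- enum (predecessor (@tle T G) v)] (children Phi (w v)).
Proof.
have memE u : (u \in enum (predecessor (@tle T G) v)) =
    (w u == rcons (w v) (label u)) by rewrite mem_enum -coding_predecessor.
apply: uniq_perm => [||x]; last 1 first.
- apply/mapP/idP => [[u]|].
    rewrite memE => /eqP wu ->.
    rewrite in_children -wu; apply: coding_in; rewrite wu; by case: (w v).
  rewrite in_children => xPhi.
  have [u wu] : exists u, w u = rcons (w v) x by apply/(coding_img wP); right.
  have lu : label u = x by rewrite (coding_label wP) wu last_rcons.
  by exists u => //; rewrite memE wu lu.
- rewrite map_inj_in_uniq ?enum_uniq // => u u'.
  rewrite !memE => /eqP wu /eqP wu' luu'.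
  by apply: (coding_inj wP); rewrite wu wu' luu'.
- exact: fset_uniq.
Qed.

Lemma coding_leaf v : leaf (@tle T G) v = (children Phi (w v) == fset0).
Proof.
have /perm_size := coding_children v; rewrite size_map -cardE => sz.
rewrite -cardfs_eq0 /= -sz; apply/forallP/eqP => [lv|/card0_eq p0 u].
  by apply: eq_card0 => u; apply/negbTE/lv.
by apply/negbT; apply: p0.
Qed.

(** The hypothesis ensures that a nonempty [Phi] contains a word of length one, hence that the root
    then has a child. *)
Lemma coding_nonleaves :
  (forall s, s \in Phi -> [:: head 0 s] \in Phi) ->
  #|[set v : 'I_(Defs.tsize G) | ~~ leaf (@tle T G) v]%SET| = tree_nonleaves Phi.
Proof.
move=> hd.
have pW : perm_eq ([::] :: Phi) (map w (enum 'I_(Defs.tsize G))).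
  rewrite perm_sym; apply: uniq_perm => [||s].
  - by rewrite map_inj_uniq ?enum_uniq //; apply: (coding_inj wP).
  - by rewrite /= fset_uniq (coding_nil wP).
  rewrite inE; apply/mapP/orP => [[v _ ->]|h].
    by have /(coding_img wP)[->|] : exists u, w u = w v; [exists v|left|right].
  have /(coding_img wP)[v <-] : s = [::] \/ s \in Phi by case: h => [/eqP|]; [left|right].
  by exists v; rewrite // mem_enum.
rewrite -sum1_card; under eq_bigl do rewrite inE coding_leaf.
rewrite big_mkcond /tree_nonleaves /forest_nonleaves.
have -> : (Phi != fset0) = (children Phi [::] != fset0).
  congr (~~ _); apply/eqP/eqP => [->|C0].
    by apply/fsetP => x; rewrite in_children !inE.
  apply/fsetP => s; rewrite inE; apply/negP => /hd; rewrite -[[:: _]]/(rcons [::] _).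
  by rewrite -in_children C0 inE.
rewrite -(big_cons _ _ _ _ xpredT (fun s => nat_of_bool (children Phi s != fset0))) /=.
rewrite (perm_big _ pW) big_map big_enum /=.
by apply: eq_bigr => v _; case: ifP.
Qed.

End Coding.

Lemma coding_iso G H m Phi w w' :
  @coding G m Phi w -> @coding H m Phi w' -> ltree_iso G H.
Proof.
move=> wP w'P.
have /choice[phi phiE] : forall v, exists u, w' u = w v.
  by move=> v; apply/(coding_img w'P)/(coding_img wP); exists v.
have /choice[psi psiE] : forall v, exists u, w u = w' v.
  by move=> v; apply/(coding_img wP)/(coding_img w'P); exists v.
exists phi; split=> [|u v|v].
- exists psi => v; first by apply: (coding_inj wP); rewrite psiE phiE.
  by apply: (coding_inj w'P); rewrite phiE psiE.
- by rewrite (coding_le w'P) !phiE (coding_le wP).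
- by rewrite (coding_label w'P) phiE (coding_label wP).
Qed.

Lemma iso_coding G H m Phi w : ltree_iso G H -> @coding H m Phi w ->
  exists w', @coding G m Phi w'.
Proof.
move=> [phi [[psi phiK psiK] phi_le phi_lab]] [w_inj w_le w_lab w_img nPhi cl].
exists (w \o phi); split=> //.
- by apply: inj_comp => //; apply: can_inj phiK.
- by move=> u v; rewrite -phi_le w_le.
- by move=> v; rewrite -phi_lab w_lab.
- move=> s; rewrite -w_img; split=> [[v <-]|[v <-]]; first by exists (phi v).
  by exists (psi v); rewrite /= psiK.
Qed.

(** The words are forced by [G]: by induction on length, the parent of a vertex has the same word in
    both codings, and the letter to append is the label. *)
Lemma coding_unique G m Phi Phi' w w' :
  @coding G m Phi w -> @coding G m Phi' w' -> Phi = Phi'.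
Proof.
move=> wP w'P.
have ww' : forall n v, size (w v) = n -> w v = w' v.
  elim=> [|n IH] v.
    move=> /size0nil wv; apply/esym/eqP; rewrite wv -(coding_maximal w'P).
    by rewrite (coding_maximal wP) wv.
  move=> sz; have [|u wv] := coding_parent wP (v := v); first by case: (w v) sz.
  have wu : w u = w' u by apply: IH; apply: succn_inj; rewrite -sz wv size_rcons.
  have : predecessor (@tle T G) u v by rewrite (coding_predecessor wP) -wv.
  by rewrite (coding_predecessor w'P) -wu -wv => /eqP.
have img s : s = [::] \/ s \in Phi <-> s = [::] \/ s \in Phi'.
  rewrite -(coding_img wP) -(coding_img w'P).
  by split=> -[v <-]; exists v; rewrite (ww' _ _ erefl).
apply/fsetP => s; have nPhi := coding_nil wP; have nPhi' := coding_nil w'P.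
case: (eqVneq s [::]) => [->|/eqP s0]; first by rewrite (negbTE nPhi) (negbTE nPhi').
apply/idP/idP => sP.
  by have [] : s = [::] \/ s \in Phi' by apply/img; right.
by have [] : s = [::] \/ s \in Phi by apply/img; right.
Qed.

Lemma coding_exists m Phi : [::] \notin Phi -> prefix_closed Phi ->
  exists (G : ltree T) w, @coding G m Phi w.
Proof.
move=> nPhi cl; pose W : seq (seq T) := [::] :: Phi.
have uW : uniq W by rewrite /= fset_uniq andbT.
pose w (i : 'I_(size W)) := nth [::] W i.
exists (LTree (fun u v => prefix (w v) (w u)) (fun v => last m (w v))), w.
split=> //=.
- by move=> u v /eqP; rewrite nth_uniq // => /eqP/val_inj.
- move=> s; split=> [[v <-]|h].
    have : w v \in W by apply: mem_nth; apply: (ltn_ord v).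
    by rewrite inE => /orP[/eqP|]; [left|right].
  have sW : s \in W by rewrite inE; case: h => [->|->]; rewrite ?eqxx ?orbT.
  have lt : (index s W < size W)%N by rewrite index_mem.
  by exists (Ordinal lt); rewrite /w nth_index.
Qed.

End Codings.

(** * From rooted trees as orders to words *)

Section OrderToWords.
Variables (V : finType) (le : rel V).
Hypothesis treeV : rooted_tree le.

Let le_refl : reflexive le. Proof. by case: treeV => -[]. Qed.
Let le_anti : antisymmetric le. Proof. by case: treeV => -[]. Qed.
Let le_trans : transitive le. Proof. by case: treeV => -[]. Qed.

(** This is one more than the depth of [v]; it serves as induction measure and as the fuel of
    [vertex_word_rec]. *)
Let up (v : V) : nat := #|[set z | le v z]%SET|.

Lemma up_lt u v : le u v -> u != v -> (up v < up u)%N.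
Proof.
move=> uv nuv; apply/proper_card/properP; split.
  by apply/fintype.subsetP => z; rewrite !inE; apply: le_trans.
exists u; rewrite !inE ?le_refl //; apply: contra nuv => vu.
by apply/eqP/le_anti; rewrite uv.
Qed.

Lemma parent_between v z : le v z -> z != v ->
  exists2 p, predecessor le p v & le p z.
Proof.
move=> vz zv; pose A := [pred q | [&& q != v, le v q & le q z]].
have Az : A z by rewrite /= zv vz le_refl.
(* Largest [up] means lowest among the elements strictly above [v], so nothing fits between. *)
case: (arg_maxnP up Az) => p /and3P[pv vp pz] pmax; exists p => //.
apply/and3P; split; rewrite 1?eq_sym //; apply/forallP => q.
apply/implyP => /andP[vq qp]; case: (eqVneq q v) => //= qv.
case: (eqVneq q p) => // qp'.
have := pmax q; rewrite /= qv vq (le_trans qp pz) => /(_ isT).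
by rewrite leqNgt up_lt.
Qed.

Lemma root_exists : exists2 r, maximal le r & forall v, le v r.
Proof.
have [_ [[r [mr ur]] _ _ _]] := treeV.
exists r => // v; have Av : le v v by [].
case: (arg_minnP up Av) => u vu umin; rewrite (ur u) //.
apply/forallP => z; apply/implyP => uz; case: (eqVneq z u) => // zu.
have := umin z (le_trans vu uz); rewrite leqNgt up_lt //.
by rewrite eq_sym.
Qed.

(** Two different parents of [v] are joined by a simple path that avoids [v], through the root if
    necessary; together with [v] it forms a cycle of at least three vertices. *)
Lemma parent_unique p p' v : predecessor le p v -> predecessor le p' v -> p = p'.
Proof.
move=> pv p'v; apply/eqP; apply/negPn/negP => pp'.
have [_ [_ _ acyclic _]] := treeV.
have [r mr rP] := root_exists.
pose e := [rel x y | [&& adjacent le x y, x != v & y != v]].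
have e_sym : symmetric e.
  by move=> x y; rewrite /= /adjacent /= orbC [(x != v) && _]andbC.
(* Climbing from a point strictly above [v] stays strictly above [v], by antisymmetry. *)
have to_root n z : (up z <= n)%N -> le v z -> z != v -> connect e z r.
  elim: n z => [|n IH] z; last first.
    move=> upz vz zv; case: (eqVneq r z) => [->|rz]; first exact: connect0.
    have [q qz _] := parent_between (rP z) rz.
    have [zq lzq _] := and3P qz.
    have qv : q != v.
      by apply: contra zv => /eqP qv; apply/eqP/le_anti; rewrite vz -qv lzq.
    have ezq : e z q by rewrite /= zv qv /adjacent /= qz orbT.
    apply: (@connect_trans _ e q); first exact: connect1.
    apply: IH (le_trans vz lzq) qv.
    by rewrite -ltnS (leq_trans _ upz) // up_lt.
  rewrite leqn0 /up cards_eq0 => up0.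
  have : z \in [set z0 | le z z0]%SET by rewrite inE.
  by rewrite (eqP up0) inE.
have conn q : predecessor le q v -> connect e q r.
  by case/and3P => vq lvq _; apply: (to_root (up q)); rewrite // eq_sym.
have : connect e p p'.
  apply: (@connect_trans _ e r); first exact: conn.
  rewrite (sym_connect_sym e_sym).
  exact: conn.
move=> /connectP[s es p'E].
case: (shortenP es) p'E => s' es' us' _ p'E.
have avoid x : x \in s' -> x != v.
  elim: s' (p) es' {us' p'E} => //= y s' IH q /andP[/and3P[_ _ yv] /IH h].
  by rewrite inE => /orP[/eqP->|/h].
have [vp _ _] := and3P pv.
have := acyclic [:: v, p & s']; rewrite /ucycle.
have -> : cycle (adjacent le) [:: v, p & s'].
  rewrite /= rcons_path -p'E; apply/and3P; split.
  - by rewrite /adjacent /= pv orbT.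
  - by apply: sub_path es' => x y /and3P[].
  - by rewrite /adjacent /= p'v.
rewrite /= in us' *; rewrite us' andbT inE negb_or vp /=.
have -> : v \notin s' by apply/negP => /avoid; rewrite eqxx.
case: s' p'E {es' us' avoid} => [|y s'] /=; first by move=> p'E; rewrite p'E eqxx in pp'.
by move=> _ /(_ isT).
Qed.

Variables (T : eqType) (lab : V -> T).
Hypothesis lab_inj : forall v u z, predecessor le v u -> predecessor le v z ->
  lab u = lab z -> u = z.

Fixpoint vertex_word_rec (n : nat) (v : V) : seq T :=
  if n is n'.+1 then
    if [pick p | predecessor le p v] is Some p then rcons (vertex_word_rec n' p) (lab v)
    else [::]
  else [::].

Definition vertex_word (v : V) : seq T := vertex_word_rec (up v) v.

Lemma vertex_word_maximal r : maximal le r -> vertex_word r = [::].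
Proof.
move=> /forallP mr; rewrite /vertex_word; case: (up r) => //= n.
case: pickP => // p /and3P[rp lrp _]; have := mr p.
by rewrite lrp /= eq_sym (negbTE rp).
Qed.

Lemma up_parent p v : predecessor le p v -> up v = (up p).+1.
Proof.
move=> pv; have [vp lvp _] := and3P pv.
rewrite /up (cardsD1 v) inE le_refl; congr (_.+1).
congr #|pred_of_set _|; apply/setP => z; rewrite !inE.
apply/andP/idP => [[zv vz]|pz].
  by have [p' p'v p'z] := parent_between vz zv; rewrite (parent_unique pv p'v).
split; last exact: le_trans pz.
by apply: contra vp => /eqP zv; apply/eqP/le_anti; rewrite lvp -zv.
Qed.

Lemma vertex_word_parent p v : predecessor le p v ->
  vertex_word v = rcons (vertex_word p) (lab v).
Proof.
move=> pv; rewrite /vertex_word (up_parent pv) /=.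
case: pickP => [p' p'v|/(_ p)]; last by rewrite pv.
by rewrite (parent_unique p'v pv).
Qed.

Lemma root_or_parent v : maximal le v \/ exists p, predecessor le p v.
Proof.
have [r mr rP] := root_exists; case: (eqVneq r v) => [<-|rv]; first by left.
by right; have [p] := parent_between (rP v) rv; exists p.
Qed.

Lemma maximal_unique u v : maximal le u -> maximal le v -> u = v.
Proof.
have [_ [[r [_ ur]] _ _ _]] := treeV.
by move=> mu mv; rewrite -(ur u mu) -(ur v mv).
Qed.

Lemma vertex_word_inj : injective vertex_word.
Proof.
move=> u v; move: {2}(size _) (leqnn (size (vertex_word u))) => n.
elim: n u v => [|n IH] u v.
  rewrite leqn0 => /nilP wu.
  case: (root_or_parent u) => [mu|[p pu]]; last first.
    by move: wu; rewrite (vertex_word_parent pu); case: (vertex_word p).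
  case: (root_or_parent v) => [mv|[p pv]]; first by move=> _; exact: maximal_unique.
  by rewrite wu (vertex_word_parent pv); case: (vertex_word p).
case: (root_or_parent u) => [mu|[p pu]].
  case: (root_or_parent v) => [mv|[p pv]]; first by move=> _ _; exact: maximal_unique.
  by rewrite (vertex_word_maximal mu) (vertex_word_parent pv); case: (vertex_word p).
rewrite (vertex_word_parent pu) size_rcons => sz.
case: (root_or_parent v) => [mv|[q qv]].
  by rewrite (vertex_word_maximal mv); case: (vertex_word p).
rewrite (vertex_word_parent qv) => /rcons_inj[/(IH _ _ sz) pq].
by rewrite -pq in qv; apply: lab_inj qv.
Qed.

Lemma vertex_word_le u v : le u v = prefix (vertex_word v) (vertex_word u).
Proof.
move: {2}(size _) (leqnn (size (vertex_word u))) => n.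
elim: n u => [|n IH] u.
  rewrite leqn0 => /nilP wu; rewrite wu prefixs0 -wu (inj_eq vertex_word_inj).
  case: (root_or_parent u) => [/forallP mu|[p pu]]; last first.
    by move: wu; rewrite (vertex_word_parent pu); case: (vertex_word p).
  by apply/idP/eqP => [|->//]; move/(implyP (mu v))/eqP.
case: (root_or_parent u) => [mu _|[p pu]].
  rewrite (vertex_word_maximal mu) prefixs0 -(vertex_word_maximal mu) (inj_eq vertex_word_inj).
  by apply/idP/eqP => [|->//]; move/(implyP (forallP mu v))/eqP.
have wu := vertex_word_parent pu; rewrite wu size_rcons => /IH pv.
have [up' lup _] := and3P pu.
apply/idP/idP => [uv|].
  case: (eqVneq v u) => [->|vu]; first by rewrite wu prefix_refl.
  have [p' p'u p'v] := parent_between uv vu.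
  rewrite (parent_unique p'u pu) pv in p'v.
  exact: prefix_trans p'v (prefix_rcons _ _).
move=> /prefixP[t]; case/lastP: t => [|t x].
  by rewrite cats0 -wu => /vertex_word_inj ->.
rewrite -rcons_cat => /rcons_inj[pE _].
by apply: le_trans lup _; rewrite pv pE prefix_prefix.
Qed.

End OrderToWords.

(** * Types of disks and curves correspond to codes *)

Section TypesAndWords.
Variables (T : zmodType) (D : set T) (S : {fset T}).

(** The common form of disks and curves: with the root label fixed to [m], they differ only in where
    [m] lies. *)
Definition labelled_tree (m : T) (G : ltree T) : Prop :=
  [/\ rooted_tree (@tle T G),
      forall v : 'I_(Defs.tsize G), ~~ is_root v -> D (label v),
      balanced G /\ distinct_predecessors G,
      root_label G m & leaf_labels_in G S].

Lemma forest_prefix_closed Phi : forest D S Phi -> prefix_closed Phi.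
Proof. by move=> [_ fP] s x /fP[]. Qed.

Section FromWords.
Variables (m : T) (Phi : {fset seq T}) (G : ltree T) (w : 'I_(Defs.tsize G) -> seq T).
Hypotheses (wP : coding m Phi w) (tPhi : tree D S m Phi).

Lemma coding_branching v : branching S (label v) (children Phi (w v)).
Proof.
rewrite (coding_label wP); case: (eqVneq (w v) [::]) => [->|wv]; first by case: tPhi.
have := coding_in wP wv; case/lastP: (w v) wv => // s x _.
by rewrite last_rcons => /(proj2 (proj1 tPhi))[].
Qed.

(** At a vertex of the cycle with longest word, both neighbours must be its parent, hence
    coincide. *)
Lemma coding_acyclic (c : seq 'I_(Defs.tsize G)) :
  ucycle (adjacent (@tle T G)) c -> (size c <= 2)%N.
Proof.
rewrite leqNgt => uc; apply/negP => c3.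
have [v0 v0c] : exists v, v \in c by case: c c3 {uc} => // v c _; exists v; rewrite inE eqxx.
case: (arg_maxnP (fun v => size (w v)) (v0c : [pred v | v \in c] v0)) => v vc vmax.
have [i c' cE] := rot_to vc.
have c'c x : x \in c' -> x \in c by move=> xc'; rewrite -(mem_rot i) cE inE xc' orbT.
have adj x : x \in c -> adjacent (@tle T G) v x -> w v = rcons (w x) (label v).
  move=> xc; rewrite /adjacent /= => /orP[]; rewrite (coding_predecessor wP) => /eqP //.
  move=> wx; have := vmax x xc; rewrite wx size_rcons /=.
  by rewrite ltnn.
move: uc; rewrite -(rot_ucycle i) cE => /andP[].
move: c3; rewrite -(size_rot i) cE => /=; case: c' c'c {cE} => [|y c'] c'c //.
case/lastP: c' c'c => [|c' z] c'c // _.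
rewrite /= !rcons_path last_rcons => /and3P[vy _ zv].
have wy := adj y (c'c y (mem_head _ _)) vy.
have zc : z \in c by apply: c'c; rewrite inE mem_rcons mem_head orbT.
have wz : w v = rcons (w z) (label v).
  by apply: adj => //; move: zv; rewrite /adjacent /= orbC.
have yz : y = z.
  by apply: (coding_inj wP); move: wy; rewrite wz => /rcons_inj[].
by rewrite yz mem_rcons mem_head andbF.
Qed.

Lemma coding_connect u v : connect (adjacent (@tle T G)) u v.
Proof.
have adj_sym : symmetric (adjacent (@tle T G)) by move=> x y; rewrite /adjacent /= orbC.
have [r wr] := coding_root wP.
suff to_r n x : size (w x) = n -> connect (adjacent (@tle T G)) x r.
  apply: (@connect_trans _ _ r); first exact: (to_r (size (w u))).
  rewrite (sym_connect_sym adj_sym); exact: (to_r (size (w v))).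
elim: n x => [|n IH] x sz.
  by rewrite (_ : x = r) ?connect0 //; apply: (coding_inj wP); rewrite wr; apply: size0nil.
have [|y wy] := coding_parent wP (v := x); first by case: (w x) sz.
apply: (@connect_trans _ _ y).
  by apply: connect1; rewrite /adjacent /= (coding_predecessor wP y) -wy eqxx orbT.
by apply: IH; apply: succn_inj; rewrite -sz wy size_rcons.
Qed.

Lemma coding_labelled_tree : labelled_tree m G.
Proof.
have [w_inj w_le w_lab w_img nPhi cl] := wP.
have size_pred v : #|predecessor (@tle T G) v| = #|` children Phi (w v)|.
  by rewrite -(perm_size (coding_children wP v)) size_map -cardE.
split.
- split; first split.
  + by move=> v; rewrite w_le prefix_refl.
  + move=> u v; rewrite !w_le => /andP[/prefixP[s wu] /prefixP[t wv]].
    move: wu; rewrite wv -catA -[X in X = _ -> _]cats0 => /eqP.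
    rewrite eqseq_cat // eqxx /= => /eqP; case: t wv => // wv _.
    by apply: w_inj; rewrite wv cats0.
  + by move=> v u z; rewrite !w_le => uv vz; apply: prefix_trans vz uv.
  split.
  + have [r wr] := coding_root wP; exists r; split; first by rewrite (coding_maximal wP) wr.
    by move=> v; rewrite (coding_maximal wP) => /eqP wv; apply: w_inj; rewrite wr wv.
  + exact: coding_connect.
  + exact: coding_acyclic.
  + move=> v; rewrite size_pred; have [[-> _]|[]//] := coding_branching v.
    by rewrite cardfs0.
- move=> v; rewrite /is_root (coding_maximal wP) => wv.
  have := coding_in wP wv; rewrite w_lab; case/lastP: (w v) wv => // s x _.
  by rewrite last_rcons => /(proj2 (proj1 tPhi))[].
- split=> [v|v u z].
    rewrite (coding_leaf wP); have [[-> _]|[_ _ ->]] := coding_branching v.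
      by rewrite eqxx.
    by rewrite -(perm_big _ (coding_children wP v)) big_map big_enum.
  rewrite !(coding_predecessor wP) => /eqP wu /eqP wz luz.
  by apply: w_inj; rewrite wu wz luz.
- by move=> v; rewrite /is_root (coding_maximal wP) w_lab => /eqP->.
- move=> v; rewrite (coding_leaf wP) => /eqP C0.
  by have [[]//|[]] := coding_branching v; rewrite C0 eqxx.
Qed.

End FromWords.

Lemma labelled_tree_coding m G : labelled_tree m G ->
  exists Phi w, @coding T G m Phi w /\ tree D S m Phi.
Proof.
move=> [rt nonrootD [bal dist] rootm leavesS].
pose w := vertex_word (@tle T G) (@label T G).
pose Phi := [fset w v | v in [pred v | ~~ maximal (@tle T G) v]]%fset.
have [r mr rP] := root_exists rt.
have w_root v : maximal (@tle T G) v -> w v = [::] by apply: vertex_word_maximal.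
have w_par p v : predecessor (@tle T G) p v -> w v = rcons (w p) (label v).
  by move=> pv; apply: vertex_word_parent.
have wPhi v : w v = [::] \/ w v \in Phi.
  case: (boolP (maximal (@tle T G) v)) => mv; first by left; exact: w_root.
  by right; apply/imfsetP; exists v.
have PhiE s : s \in Phi -> exists v p,
    [/\ predecessor (@tle T G) p v, s = w v & s = rcons (w p) (label v)].
  move=> /imfsetP[v /= /negP nmv ->].
  by have [//|[p pv]] := root_or_parent rt v; exists v, p; split=> //; exact: w_par.
have wP : coding m Phi w.
  split.
  - by apply: vertex_word_inj.
  - by apply: vertex_word_le.
  - move=> v; have [mv|[p pv]] := root_or_parent rt v.
      by rewrite w_root //=; apply: rootm.
    by rewrite (w_par _ _ pv) last_rcons.
  - move=> s; split=> [[v <-]|[->|/PhiE[v [_ [_ -> _]]]]] //; last by exists v.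
    by exists r; exact: w_root.
  - by apply/negP => /PhiE[v [p [_ _]]]; case: (w p).
  - by move=> s x /PhiE[v [p [_ _ /rcons_inj[-> _]]]].
have br v : branching S (label v) (children Phi (w v)).
  case: (boolP (leaf (@tle T G) v)) => lv.
    by left; split; [apply/eqP; rewrite -(coding_leaf wP)|exact: leavesS].
  right; split; first by rewrite -(coding_leaf wP).
    rewrite -(perm_size (coding_children wP v)) size_map -cardE.
    by have [_ [_ _ _]] := rt; apply.
  by rewrite -(perm_big _ (coding_children wP v)) big_map big_enum; apply: bal.
exists Phi, w; split=> //; split.
  split; first exact: (coding_nil wP).
  move=> s x /[dup] sxP /PhiE[v [p [pv wv]]] /[dup] wv' /rcons_inj[sE xE].
  split; first by rewrite sE.
    rewrite xE; apply: nonrootD; rewrite /is_root (coding_maximal wP) -wv wv'.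
    by case: (w p).
  by rewrite wv xE; apply: br.
by rewrite -(rootm r mr) -(w_root r mr).
Qed.

Lemma type_of_eqP G H : type_of G = type_of H <-> @ltree_iso T G H.
Proof.
have P := @eqmodP _ (ltree_iso_equiv T) G H.
by rewrite /type_of; split=> [/P/asboolP|iso] //; apply/P/asboolP.
Qed.

(** [nonleaves] counts on a chosen representative of the class, so the coding has to be transported
    to it. *)
Lemma nonleaves_coding G m Phi w : @coding T G m Phi w -> forest D S Phi ->
  nonleaves (type_of G) = tree_nonleaves Phi.
Proof.
move=> wP fPhi; rewrite /nonleaves; set H := repr _.
have /type_of_eqP isoHG : type_of H = type_of G by rewrite /type_of /H reprK.
have [w' w'P] := iso_coding isoHG wP.
rewrite (coding_nonleaves w'P) // => -[|x s] sP /=; last exact: (forest_head fPhi sP).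
by have := proj1 fPhi; rewrite sP.
Qed.

(** A code determines its tree up to isomorphism, and the tree determines its code. An arbitrary [F]
    covers the sign conventions of disks and of curves alike. *)
Lemma sum_labelled_types (k : fieldType) m (F : nat -> k) :
  \sum_(X \in [set type_of G | G in labelled_tree m]) F (nonleaves X) =
  \sum_(Phi \in tree D S m) F (tree_nonleaves Phi).
Proof.
have /choice[g gP] : forall Phi, exists G, tree D S m Phi -> exists w, @coding T G m Phi w.
  move=> Phi; case: (pselect (tree D S m Phi)) => [[fPhi _]|ntPhi].
    have [G [w wP]] := coding_exists m (proj1 fPhi) (forest_prefix_closed fPhi).
    by exists G => _; exists w.
  (* A dummy without vertices, for sets of words that are not codes. *)
  by exists (@LTree T 0 (fun _ _ => true) (fun _ => 0)) => /ntPhi.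
have bij : set_bij (tree D S m) [set type_of G | G in labelled_tree m] (@type_of T \o g).
  split.
  - move=> Phi tPhi; have [w wP] := gP _ tPhi.
    by exists (g Phi) => //; apply: coding_labelled_tree wP tPhi.
  - move=> Phi Phi' /set_mem tPhi /set_mem tPhi' /= /type_of_eqP iso.
    have [w wP] := gP _ tPhi; have [w' w'P] := gP _ tPhi'.
    have [w2 w2P] := iso_coding iso w'P.
    exact: coding_unique wP w2P.
  - move=> X [G /labelled_tree_coding[Phi [w [wP tPhi]]] <-].
    exists Phi => //=; have [w' w'P] := gP _ tPhi.
    exact/type_of_eqP/(coding_iso w'P wP).
rewrite (reindex_fsbig _ _ _ _ bij); apply: eq_fsbigr => Phi /set_mem tPhi.
have [w wP] := gP _ tPhi.
by congr F; apply: (nonleaves_coding wP); case: tPhi.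
Qed.

Lemma disk_typesE P Q m : (P `\` Q)%classic = D -> D m ->
  disk_types P Q S m = [set type_of G | G in labelled_tree m].
Proof.
move=> PQ Dm; rewrite /disk_types /tropical_disk PQ; congr (_ @` _).
apply/seteqP; split=> G /=.
  by move=> [[rt lD bal dist] rm lS]; split.
move=> [rt lD [bal dist] rm lS]; split=> //; split=> // v.
case: (boolP (is_root v)) => rv; last exact: lD.
by rewrite (rm v rv).
Qed.

Lemma curve_typesE P Q m : (P `\` Q)%classic = D -> Q m ->
  curve_types P Q S m = [set type_of G | G in labelled_tree m].
Proof.
move=> PQ Qm; rewrite /curve_types /tropical_curve PQ; congr (_ @` _).
apply/seteqP; split=> G /=.
  move=> [[rt lD bal dist] rm lS]; split=> // v rv.
  by have := lD v; rewrite (negbTE rv).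
move=> [rt lD [bal dist] rm lS]; split=> //; split=> // v.
by case: ifPn => rv; [rewrite (rm v rv)|exact: lD].
Qed.

End TypesAndWords.

(** * The logarithm of nilpotent elements *)

Section LogSum.
Variable A : comNzRingType.

(** The first [n] terms of log(1 + x). As [A] has no division, the coefficients are a sequence,
    later fixed by [c i *+ i.+1 = (-1) ^+ i]. *)
Definition log_sum (c : nat -> A) (n : nat) (x : A) : A :=
  \sum_(i < n) c i * x ^+ i.+1.

Lemma geometric_inverse n (w : A) : w ^+ n = 0 ->
  (1 + w) * \sum_(i < n) (- w) ^+ i = 1.
Proof.
move=> wn; have := subrX1 (- w) n; rewrite exprNn wn mulr0 sub0r.
by rewrite -opprD mulNr => /oppr_inj; rewrite addrC => <-.
Qed.

Lemma nilpotent_leq K n (x : A) : (K <= n)%N -> x ^+ K = 0 -> x ^+ n = 0.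
Proof. by move=> /subnK <- xK; rewrite exprD xK mulr0. Qed.

Lemma nilpotentD K n (x y : A) : (K + K <= n)%N -> x ^+ K = 0 -> y ^+ K = 0 ->
  (x + y) ^+ n = 0.
Proof.
move=> Kn xK yK; rewrite exprDn big1 // => i _.
case: (leqP K i) => Ki; first by rewrite (nilpotent_leq Ki yK) mulr0 mul0rn.
rewrite (@nilpotent_leq K _ x) ?mul0r ?mul0rn //.
rewrite leq_subRL; last by rewrite -ltnS.
by apply: leq_trans Kn; rewrite leq_add2r ltnW.
Qed.

End LogSum.

Section LogAdditive.
Variables (A : comNzRingType) (c : nat -> A).
Hypothesis cE : forall i, c i *+ i.+1 = (-1) ^+ i.

Let cP (i : nat) : {poly A} := (c i)%:P.

(** For nilpotent [w] the geometric sum inverts 1 + w, so this is the logarithmic derivative w' / (1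
    + w). *)
Lemma deriv_log_sum n (w : {poly A}) :
  (log_sum cP n w)^`() = w^`() * \sum_(i < n) (- w) ^+ i.
Proof.
rewrite /log_sum raddf_sum mulr_sumr; apply: eq_bigr => i _ /=.
rewrite mul_polyC derivZ deriv_exp /= -scalerMnr -scaler_nat scalerA mulr_natl cE.
by rewrite -mul_polyC polyC_exp polyCN polyC1 [(- w) ^+ i]exprNn mulrCA.
Qed.

Lemma horner_log_sum n (w : {poly A}) t :
  (log_sum cP n w).[t] = log_sum c n w.[t].
Proof.
by rewrite horner_sum; apply: eq_bigr => i _; rewrite hornerM hornerC horner_exp.
Qed.

(** Positive integers are invertible in [A], with [(-1) ^+ i * c i] as inverse of [i.+1], so a
    polynomial of derivative 0 is constant. *)
Lemma horner_deriv0 (p : {poly A}) s t : p^`() = 0 -> p.[s] = p.[t].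
Proof.
move=> p0; suff -> : p = (p`_0)%:P by rewrite !hornerC.
apply/polyP => -[|i]; rewrite coefC //=.
have := coef_deriv p i; rewrite p0 coef0 => /esym pi.
have -> : p`_i.+1 = (-1) ^+ i * (c i * (p`_i.+1 *+ i.+1)).
  by rewrite mulrnAr -mulrnAl cE mulrA -expr2 sqrr_sign mul1r.
by rewrite pi !mulr0.
Qed.

(* Along the path from x to x + y + x y = (1 + x)(1 + y) - 1 given by
   w(t) = x + t y (1 + x), log (1 + w(t)) - log (1 + t y) has derivative 0. *)
Lemma log_sumD K n (x y : A) : (K + K <= n)%N -> x ^+ K = 0 -> y ^+ K = 0 ->
  log_sum c n (x + y + x * y) = log_sum c n x + log_sum c n y.
Proof.
move=> Kn xK yK.
have Kn' : (K <= n)%N := leq_trans (leq_addr K K) Kn.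
pose X := x%:P; pose v : {poly A} := 'X * y%:P; pose w := X + v * (1 + X).
have vK : v ^+ K = 0 by rewrite exprMn -polyC_exp yK polyC0 mulr0.
have wn : w ^+ n = 0.
  apply: nilpotentD Kn _ _; first by rewrite -polyC_exp xK polyC0.
  by rewrite exprMn vK mul0r.
have vn := nilpotent_leq Kn' vK.
have v' : v^`() = y%:P by rewrite derivM derivX derivC mul1r mulr0 addr0.
have w' : w^`() = y%:P * (1 + X).
  by rewrite derivD derivC add0r derivM derivD derivC -[1]/(1%:P) derivC !addr0 mulr0 addr0 v'.
have Gw := geometric_inverse wn; have Gv := geometric_inverse vn.
have wv : 1 + w = (1 + X) * (1 + v) by rewrite /w addrA [RHS]mulrDr mulr1 [v * _]mulrC.
pose phi := log_sum cP n w - log_sum cP n v.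
have phi0 : phi^`() = 0.
  have phiw : phi^`() * (1 + w) = 0.
    rewrite /phi derivB !deriv_log_sum v' w' mulrBl -[X in X - _]mulrA.
    rewrite [_ * (1 + w)]mulrC Gw mulr1 wv -[X in _ - X]mulrA.
    by rewrite [(1 + X) * _]mulrC [X in _ - y%:P * X]mulrA [_ * (1 + v)]mulrC Gv mul1r subrr.
  by rewrite -[LHS]mulr1 -Gw mulrA phiw mul0r.
have := horner_deriv0 1 0 phi0; rewrite /phi !(hornerD, hornerN) !horner_log_sum.
rewrite !hornerE /=. rewrite (_ : log_sum c n 0 = 0); last first.
  by rewrite /log_sum big1 // => i _; rewrite expr0n mulr0.
by rewrite subr0 => /eqP; rewrite subr_eq mulrDr mulr1 addrA [y * x]mulrC => /eqP.
Qed.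

(** [J] keeps the nilpotency order of the partial products bounded by one [K], whatever the number
    of factors. *)
Lemma log_sum_prod K n (I : eqType) (s : seq I) (x : I -> A) (J : A -> Prop) :
  (K + K <= n)%N -> J 0 -> (forall a b, J a -> J b -> J (a + b + a * b)) ->
  (forall a, J a -> a ^+ K = 0) -> {in s, forall i, J (x i)} ->
  log_sum c n (\prod_(i <- s) (1 + x i) - 1) = \sum_(i <- s) log_sum c n (x i).
Proof.
move=> Kn J0 JD JK Jx.
suff [] : J (\prod_(i <- s) (1 + x i) - 1) /\
    log_sum c n (\prod_(i <- s) (1 + x i) - 1) = \sum_(i <- s) log_sum c n (x i) by [].
elim: s Jx => [_|i s IHs Jx].
  rewrite !big_nil subrr; split=> //.
  by rewrite /log_sum big1 // => i _; rewrite expr0n mulr0.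
have [j js|Ju IH] := IHs _; first by apply: Jx; rewrite inE js orbT.
have Jxi : J (x i) by apply: Jx; rewrite mem_head.
rewrite !big_cons -IH; set u := \prod_(j <- s) _ in Ju *.
have -> : (1 + x i) * u - 1 = x i + (u - 1) + x i * (u - 1).
  by rewrite mulrDl mul1r mulrBr mulr1 [RHS]addrC [RHS]addrA subrK [RHS]addrA [u + _]addrC.
by split; [apply: JD|apply: log_sumD Kn _ _; apply: JK].
Qed.

End LogAdditive.

(** * Truncated monoid algebras *)

(* The exponents of a monomial basis of a quotient of the monoid algebra: the
   product of two basis elements is zero when the sum leaves [exponents]. *)
Record truncation (T : zmodType) := Truncation {
  exponents : {fset T};
  truncation0 : 0 \in exponents;
  truncationD : forall x y z, x \in exponents -> y \in exponents ->
    z \in exponents -> x + y + z \in exponents -> x + y \in exponents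
}.

(** A separate name, because the product will be truncated convolution instead of the pointwise one;
    only the additive structure is copied. *)
Definition truncated (T : zmodType) (k : fieldType) (B : truncation T) : Type :=
  {ffun exponents B -> k}.

Definition truncated_fun (T : zmodType) (k : fieldType) (B : truncation T)
    (f : truncated k B) : exponents B -> k :=
  (f : {ffun exponents B -> k}).
Coercion truncated_fun : truncated >-> Funclass.

HB.instance Definition _ (T : zmodType) (k : fieldType) (B : truncation T) :=
  GRing.Zmodule.copy (truncated k B) {ffun exponents B -> k}.

Section TruncatedRing.
Variables (T : zmodType) (k : fieldType) (B : truncation T).
Implicit Types f g h : truncated k B.

Definition trunc (F : T -> k) : truncated k B :=
  ([ffun a => F (val a)] : {ffun exponents B -> k}).

Definition trunc_mul f g : truncated k B :=
  ([ffun d => \sum_a \sum_b if val a + val b == val d then f a * g b else 0]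
    : {ffun exponents B -> k}).

Lemma truncatedP f g : f =1 g -> f = g.
Proof. by move=> fg; apply/ffunP. Qed.

Lemma truncE F a : trunc F a = F (val a).
Proof. exact: ffunE. Qed.

Lemma trunc_mulE f g d :
  trunc_mul f g d = \sum_a \sum_b if val a + val b == val d then f a * g b else 0.
Proof. exact: ffunE. Qed.

Lemma truncated0E a : (0 : truncated k B) a = 0.
Proof. exact: ffunE. Qed.

Lemma truncatedDE f g a : (f + g : truncated k B) a = f a + g a.
Proof. exact: ffunE. Qed.

Lemma truncatedNE f a : (- f : truncated k B) a = - f a.
Proof. exact: ffunE. Qed.

Let truncatedE := (truncE, trunc_mulE, truncated0E, truncatedDE, truncatedNE).

Lemma trunc_mulC : commutative trunc_mul.
Proof.
move=> f g; apply: truncatedP => d; rewrite !truncatedE exchange_big /=.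
by apply: eq_bigr => a _; apply: eq_bigr => b _; rewrite addrC mulrC.
Qed.

(** By [truncationD] the inner sum is an exponent whenever the total is, so truncating in between
    loses no term. Associativity then follows from commutativity. *)
Lemma trunc_mul3 f g h d : (trunc_mul f (trunc_mul g h) ) d =
  \sum_a \sum_p \sum_q
     if val a + (val p + val q) == val d
     then f a * (g p * h q) else 0.
Proof.
rewrite truncatedE; apply: eq_bigr => a _.
transitivity (\sum_(b : exponents B) \sum_(p : exponents B)
    \sum_(q : exponents B) if (val a + val b == val d) && (val p + val q == val b)
    then f a * (g p * h q) else 0).
  apply: eq_bigr => b _; case: eqP => _ /=; last first.
    by rewrite big1 // => p _; rewrite big1.
  rewrite truncatedE mulr_sumr; apply: eq_bigr => p _; rewrite mulr_sumr.
  by apply: eq_bigr => q _; case: ifP; rewrite ?mulr0.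
rewrite exchange_big /=; apply: eq_bigr => p _.
rewrite exchange_big /=; apply: eq_bigr => q _.
case: ifP => [/eqP apq|apq]; last first.
  rewrite big1 // => b _; case: ifP => // /andP[ab /eqP pq].
  by rewrite pq ab in apq.
have pqB : val p + val q \in exponents B.
  by apply: (truncationD (valP p) (valP q) (valP a)); rewrite addrC apq (valP d).
rewrite (bigD1 [` pqB]%fset) //= apq !eqxx big1 ?addr0 // => b bpq.
case: ifP => // /andP[_ /eqP pq]; case/eqP: bpq.
by apply: val_inj; rewrite /= pq.
Qed.

Lemma trunc_mulA : associative trunc_mul.
Proof.
move=> f g h; rewrite [RHS]trunc_mulC; apply: truncatedP => d; rewrite !trunc_mul3.
rewrite [RHS]exchange_big /=; apply: eq_bigr => a _.
rewrite [RHS]exchange_big /=; apply: eq_bigr => p _; apply: eq_bigr => q _.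
have -> : val q + (val a + val p) = val a + (val p + val q) by rewrite addrC addrA.
by rewrite [in RHS]mulrC mulrA.
Qed.

Lemma trunc_zmonM (m : T) (c : k) f d : (trunc_mul (trunc (zmon c m)) f ) d =
  \sum_b if (m \in exponents B) && (m + val b == val d) then c * f b else 0.
Proof.
rewrite truncatedE exchange_big /=; apply: eq_bigr => b _.
case: (boolP (m \in exponents B)) => mB /=; last first.
  rewrite big1 // => a _; rewrite truncatedE /zmon;
  case: (eqVneq (val a) m) => [am|_]; last by rewrite mul0r if_same.
  by have := valP a; rewrite /= am (negbTE mB).
rewrite (bigD1 [` mB]%fset) //= truncatedE /zmon eqxx big1 ?addr0 // => a am.
rewrite truncatedE /zmon; case: (eqVneq (val a) m) => [h|_]; last by rewrite mul0r if_same.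
by case/eqP: am; apply: val_inj.
Qed.

Lemma trunc_zmon0M (c : k) f d :
  (trunc_mul (trunc (zmon c 0)) f ) d = c * f d.
Proof.
rewrite trunc_zmonM truncation0 /= (bigD1 d) //= add0r eqxx big1 ?addr0 // => b bd.
by rewrite add0r (inj_eq val_inj) (negbTE bd).
Qed.

Lemma trunc_mul1 : left_id (trunc (zmon 1 0)) trunc_mul.
Proof. by move=> f; apply: truncatedP => d; rewrite trunc_zmon0M mul1r. Qed.

Lemma trunc_mulDl : left_distributive trunc_mul +%R.
Proof.
move=> f g h; apply: truncatedP => d; rewrite !truncatedE -big_split; apply: eq_bigr => a _.
rewrite -big_split; apply: eq_bigr => b _ /=; rewrite !truncatedE.
by case: ifP; rewrite ?addr0 // mulrDl.
Qed.

Lemma trunc_1_neq0 : trunc (zmon 1 0) != 0.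
Proof.
apply/eqP => /(congr1 (fun u : truncated k B => u [` truncation0 B]%fset)).
rewrite !truncatedE /zmon eqxx => /eqP.
by rewrite oner_eq0.
Qed.

HB.instance Definition _ := GRing.Zmodule_isComNzRing.Build (truncated k B)
  trunc_mulA trunc_mulC trunc_mul1 trunc_mulDl trunc_1_neq0.

Lemma truncM f g d : (f * g : truncated k B) d =
  \sum_a \sum_b if val a + val b == val d then f a * g b else 0 :> k.
Proof. exact: trunc_mulE. Qed.

Lemma truncD F G : trunc (F + G) = trunc F + trunc G.
Proof. by apply: truncatedP => d; rewrite !truncatedE. Qed.

Lemma truncB F G : trunc (F - G) = trunc F - trunc G.
Proof. by apply: truncatedP => d; rewrite !truncatedE. Qed.

Lemma trunc1 : trunc (zmon 1 0) = 1.
Proof. by []. Qed.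

Lemma trunc_zmonX (m : T) (c : k) i d :
  (trunc (zmon c m) ^+ i : truncated k B) d != 0 -> val d = m *+ i.
Proof.
elim: i d => [|i IH] d.
  by rewrite expr0 -trunc1 truncatedE /zmon mulr0n; case: (eqVneq (val d) 0) => // _; rewrite eqxx.
apply: contraNeq => dm; rewrite exprS trunc_zmonM big1 // => b _.
case: ifP => // /andP[_ /eqP bd];
have [->|/IH bm] := eqVneq ((trunc (zmon c m) ^+ i : truncated k B) b) 0.
  exact: mulr0.
by rewrite mulrS -bm bd eqxx in dm.
Qed.

Definition trunc_const (c : k) : truncated k B := trunc (zmon c 0).

Lemma trunc_constM c f d : (trunc_const c * f : truncated k B) d = c * f d.
Proof. exact: trunc_zmon0M. Qed.

Lemma trunc_const_sign i : trunc_const ((-1) ^+ i) = (-1) ^+ i.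
Proof.
elim: i => [|i IH]; first by rewrite !expr0.
rewrite !exprS -IH !mulN1r; apply: truncatedP => d; rewrite !truncatedE /zmon.
by case: ifP; rewrite ?oppr0.
Qed.

Lemma trunc_constMn c i : trunc_const c *+ i = trunc_const (c *+ i).
Proof.
elim: i => [|i IH]; last rewrite !mulrS IH; apply: truncatedP => d; rewrite !truncatedE /zmon.
  by case: ifP; rewrite ?mulr0n.
by case: ifP; rewrite ?addr0.
Qed.

End TruncatedRing.

(** * Truncation of power series by degree *)

Section Series.
Variables (T : zmodType) (k : fieldType) (P : set T) (deg : T -> nat).
Hypothesis degP : degree P deg.

Let P0 := degree_in0 degP.
Let PD := degree_inD degP.
Let deg0 := degree0 degP.
Let deg_gt0 := degree_gt0 degP.
Let degD := degreeD degP.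
Let finite_ball := degree_ball degP.


Definition ball (N : nat) : {fset T} := fset_set [set x | P x /\ (deg x <= N)%N].

Lemma in_ball N x : (x \in ball N) <-> P x /\ (deg x <= N)%N.
Proof. by rewrite in_fset_set // inE. Qed.

Lemma ball0 N : 0 \in ball N.
Proof. by apply/in_ball; rewrite deg0. Qed.

Lemma ballD N x y z : x \in ball N -> y \in ball N -> z \in ball N ->
  x + y + z \in ball N -> x + y \in ball N.
Proof.
move=> /in_ball[Px _] /in_ball[Py _] /in_ball[Pz _] /in_ball[_ le]; apply/in_ball.
have Pxy := PD Px Py; split=> //; apply: leq_trans le.
exact: leq_trans (leq_addr _ _) (degD Pxy Pz).
Qed.

Definition ball_truncation N : truncation T := Truncation (ball0 N) (@ballD N).

Lemma conv_binomial (c : k) m (h : T -> k) y : m != 0 ->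
  conv (zmon 1 0 + zmon c m) h y = h y + c * h (y - m).
Proof.
move=> m0; rewrite /conv (fsbigTE [fset 0; m]%fset) => [|x]; last first.
  rewrite !inE negb_or => /andP[x0 xm].
  by rewrite addrfctE /zmon (negbTE x0) (negbTE xm) addr0 mul0r.
rewrite big_fsetU1 ?inE 1?eq_sym //= big_seq_fset1 addrfctE /zmon !eqxx.
by rewrite (negbTE m0) eq_sym (negbTE m0) addr0 add0r mul1r subr0.
Qed.

Lemma power_series_zmon (c : k) m : P m -> power_series P (zmon c m).
Proof. by move=> Pm x; rewrite /zmon; case: (eqVneq x m) => [->//|_]; rewrite eqxx. Qed.

Lemma power_seriesD (f g : T -> k) : power_series P f -> power_series P g ->
  power_series P (f + g).
Proof.
move=> fP gP m; rewrite addrfctE; have [f0|/fP //] := eqVneq (f m) 0.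
by rewrite f0 add0r => /gP.
Qed.

Lemma power_series_conv (f g : T -> k) : power_series P f -> power_series P g ->
  power_series P (conv f g).
Proof.
move=> fP gP m fgm; apply: contrapT => nPm; move/eqP: fgm; apply.
apply: fsbig1 => x _; apply/eqP; rewrite mulf_eq0; apply/orP.
have [fx|/fP Px] := eqVneq (f x) 0; first by left.
right; apply: contraT => /gP Pmx; case: nPm.
by rewrite -(subrK x m); apply: PD.
Qed.

(** By superadditivity, both parts of a decomposition in [P] of an exponent of degree at most [N]
    have degree at most [N]. *)
Lemma trunc_conv N (f g : T -> k) : power_series P f -> power_series P g ->
  trunc (ball_truncation N) (conv f g) = trunc _ f * trunc _ g.
Proof.
move=> fP gP; apply: truncatedP => d; rewrite truncE truncM /conv.
have /in_ball[Pd dN] := valP d.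
rewrite (fsbigTE (ball N)) => [|x xN]; last first.
  have [->|/fP Px] := eqVneq (f x) 0; first by rewrite mul0r.
  have [->|/gP Pdx] := eqVneq (g (val d - x)) 0; first by rewrite mulr0.
  case/negP: xN; apply/in_ball; split=> //; apply: leq_trans dN.
  by rewrite -(subrK x (val d)) addrC; apply: leq_trans (degD Px Pdx); apply: leq_addr.
rewrite big_seq_fsetE /=; apply: eq_bigr => a _.
have [fa0|/fP Pa] := eqVneq (f (val a)) 0.
  by rewrite fa0 mul0r big1 // => b _; rewrite !truncE fa0 mul0r if_same.
have [ga0|/gP Pda] := eqVneq (g (val d - val a)) 0.
  rewrite ga0 mulr0 big1 // => b _; rewrite !truncE; case: eqP => // abd.
  have -> : val b = val d - val a.
    by apply/eqP; rewrite eq_sym subr_eq addrC eq_sym; apply/eqP.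
  by rewrite ga0 mulr0.
have bN : val d - val a \in exponents (ball_truncation N).
  apply/in_ball; split=> //; apply: leq_trans dN.
  rewrite -[X in (_ <= deg X)%N](subrK (val a)).
  by apply: leq_trans (degD Pda Pa); apply: leq_addr.
rewrite (bigD1 [` bN]%fset) //= [_ + (_ - _)]addrC subrK eqxx !truncE big1 ?addr0 // => b bN'.
case: eqP => // abd; case/eqP: bN'; apply: val_inj => /=.
by apply/eqP; rewrite eq_sym subr_eq addrC eq_sym; apply/eqP.
Qed.

Lemma conv_exp_series (f : T -> k) i : power_series P f -> power_series P (conv_exp f i).
Proof.
move=> fP; elim: i => [|i IH]; first exact: power_series_zmon.
exact: power_series_conv.
Qed.

Lemma trunc_conv_exp N (f : T -> k) i : power_series P f ->
  trunc (ball_truncation N) (conv_exp f i) = trunc _ f ^+ i.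
Proof.
move=> fP; elim: i => [|i IH]; first by rewrite expr0 -trunc1.
rewrite exprS -IH -trunc_conv //; exact: conv_exp_series.
Qed.

Lemma finite_product_series (F : T -> T -> k) (s : seq T) :
  {in s, forall m, power_series P (F m)} ->
  power_series P (\big[@conv T k / zmon 1 0]_(m <- s) F m).
Proof.
elim: s => [_|m s IH sP]; first by rewrite big_nil; apply: power_series_zmon.
rewrite big_cons; apply: power_series_conv; first exact/sP/mem_head.
by apply: IH => x xs; apply: sP; rewrite inE xs orbT.
Qed.

Lemma trunc_product N (F : T -> T -> k) (s : seq T) :
  {in s, forall m, power_series P (F m)} ->
  trunc (ball_truncation N) (\big[@conv T k / zmon 1 0]_(m <- s) F m) =
  \prod_(m <- s) trunc _ (F m).
Proof.
elim: s => [_|m s IH sP]; first by rewrite !big_nil.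
have sP' : {in s, forall m, power_series P (F m)}.
  by move=> x xs; apply: sP; rewrite inE xs orbT.
rewrite !big_cons trunc_conv ?IH //; first exact/sP/mem_head.
exact: finite_product_series.
Qed.

Section Filtration.
Variable N : nat.
Let B := ball_truncation N.
Implicit Types u v : truncated k B.

Definition vanishing (d : nat) u : Prop := forall a, (deg (val a) < d)%N -> u a = 0.

Lemma vanishingD d u v : vanishing d u -> vanishing d v -> vanishing d (u + v).
Proof. by move=> ud vd a ad; rewrite truncatedDE ud // vd // addr0. Qed.

Lemma vanishingM d e u v : vanishing d u -> vanishing e v -> vanishing (d + e) (u * v).
Proof.
move=> ud ve a ade; rewrite truncM big1 // => x _; rewrite big1 // => y _.
case: eqP => // xya; have /in_ball[Px _] := valP x; have /in_ball[Py _] := valP y.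
case: (ltnP (deg (val x)) d) => xd; first by rewrite ud // mul0r.
rewrite ve ?mulr0 // ltnNge; apply/negP => ye; move: ade; rewrite ltnNge => /negP[].
by apply: leq_trans (leq_add xd ye) _; rewrite -xya; apply: degD.
Qed.

Lemma vanishing_le d e u : (d <= e)%N -> vanishing e u -> vanishing d u.
Proof. by move=> de ue a ad; apply: ue; apply: leq_trans de. Qed.

Lemma vanishingX i u : vanishing 1 u -> vanishing i (u ^+ i).
Proof.
by move=> u1; elim: i => // i IH; rewrite exprS -add1n; apply: vanishingM.
Qed.

Lemma vanishing_nilpotent u : vanishing 1 u -> u ^+ N.+1 = 0.
Proof.
move=> /(@vanishingX N.+1) uN; apply: truncatedP => a; rewrite uN ?truncated0E // ltnS.
by have /in_ball[] := valP a.
Qed.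

(** From exponent 2 on, every term of the factorization of the difference contains [u - v] and
    another factor of positive order, which gains one degree. *)
Lemma vanishing_expB d i u v : vanishing 1 u -> vanishing 1 v -> vanishing d (u - v) ->
  vanishing d.+1 (u ^+ i.+2 - v ^+ i.+2).
Proof.
move=> u1 v1 uv.
have uvi j : vanishing d (u ^+ j.+1 - v ^+ j.+1) -> vanishing d.+1 (u ^+ j.+2 - v ^+ j.+2).
  move=> uvj; rewrite exprS [v ^+ _]exprS.
  have -> : u * u ^+ j.+1 - v * v ^+ j.+1 =
      u * (u ^+ j.+1 - v ^+ j.+1) + (u - v) * v ^+ j.+1.
    by rewrite mulrBr mulrBl addrA subrK.
  apply: vanishingD; first by rewrite -add1n; apply: vanishingM.
  rewrite -addn1; apply: vanishingM => //.
  by apply: vanishing_le (@vanishingX j.+1 _ v1).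
apply: (uvi i); elim: i => [|i IH]; first by rewrite !expr1.
by apply: vanishing_le (uvi _ IH).
Qed.

Hypothesis char0 : [pchar k] =i pred0.

Definition log_coef (i : nat) : truncated k B := trunc_const B ((-1) ^+ i / i.+1%:R).

Lemma natf_neq0 i : (i.+1%:R : k) != 0.
Proof. by rewrite (proj1 (pcharf0P k) char0). Qed.

Lemma log_coefE i : log_coef i *+ i.+1 = (-1) ^+ i.
Proof.
rewrite /log_coef trunc_constMn -trunc_const_sign; congr trunc_const.
by rewrite -[LHS]mulr_natr divfK ?natf_neq0.
Qed.

(* In degree d, the logarithms of 1 + u and 1 + v differ by u - v only, once
   u and v agree in lower degrees. *)
Lemma log_sum_inj n (E : set T) u v : (0 < n)%N -> vanishing 1 u -> vanishing 1 v ->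
  (forall a, ~ E (val a) -> u a = v a) ->
  (forall a, E (val a) -> (log_sum log_coef n u : truncated k B) a =
    (log_sum log_coef n v : truncated k B) a) -> u = v.
Proof.
case: n => // n _ u1 v1 uv_out luv.
suff uvd d : vanishing d (u - v).
  apply: truncatedP => a; apply/eqP; rewrite -subr_eq0 -truncatedNE -truncatedDE.
  by apply/eqP/(uvd (deg (val a)).+1).
elim: d => // d IH a ad; case: (pselect (E (val a))) => [Ea|/uv_out uva]; last first.
  by rewrite truncatedDE truncatedNE uva subrr.
have c0 : log_coef 0 = 1 by have := log_coefE 0; rewrite mulr1n.
pose tl x : truncated k B := \sum_(i < n) log_coef i.+1 * x ^+ i.+2.
have tail : vanishing d.+1 (tl u - tl v).
  rewrite /tl -sumrB; apply: big_ind.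
  - by move=> b _; rewrite truncated0E.
  - by move=> x y; apply: vanishingD.
  - move=> i _; rewrite -mulrBr -[d.+1]add0n; apply: vanishingM => //.
    exact: vanishing_expB.
have logE x : log_sum log_coef n.+1 x = x + tl x.
  by rewrite /log_sum big_ord_recl c0 expr1 mul1r; congr (_ + _); apply: eq_bigr.
move: (luv a Ea) (tail a ad); rewrite !logE; move: (tl u) (tl v) => U V.
rewrite !truncatedDE !truncatedNE => eUV /subr0_eq UV.
by move: eUV; rewrite UV => /addIr ->; rewrite subrr.
Qed.

(** [log_partial] sums over 1 <= i < n.+1, thus [n] terms; after the shift of [i] the sign
    (-1)^(i+2) is (-1)^i. *)
Lemma trunc_log_partial (f : T -> k) n : power_series P f ->
  trunc B (log_partial f n.+1) = log_sum log_coef n (trunc B f - 1).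
Proof.
move=> fP; rewrite /log_partial big_add1 big_mkord /log_sum.
have f1P : power_series P (f - zmon 1 0).
  move=> x; rewrite addrfctE opprfctE; have [fx|/fP//] := eqVneq (f x) 0.
  by rewrite fx add0r oppr_eq0; apply: power_series_zmon.
have truncS (s : seq (T -> k)) :
    trunc B (\sum_(h <- s) h) = \sum_(h <- s) trunc B h :> truncated k B.
  elim: s => [|h s IH]; last by rewrite !big_cons truncD IH.
  by rewrite !big_nil; apply: truncatedP => a; rewrite truncE.
rewrite -(big_map (fun i : 'I_n => _) xpredT id) truncS big_map; apply: eq_bigr => i _.
rewrite -trunc1 -truncB -trunc_conv_exp //; apply: truncatedP => a.
by rewrite trunc_constM !truncE /= !exprS mulrA mulrNN mul1r mul1r.
Qed.

Lemma log_sum_log (f L : T -> k) : power_series P f -> is_log P f L ->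
  (forall j m, power_exponents P j m -> (j <= deg m)%N) ->
  exists n0, forall n, (n0 <= n)%N ->
  forall a : exponents B, (log_sum log_coef n (trunc B f - 1) : truncated k B) a = L (val a).
Proof.
move=> fP [_ Llim] peP; have [n0 n0P] := Llim N.+1; exists n0 => n n0n a.
rewrite -trunc_log_partial // truncE; apply/esym/eqP; rewrite -subr_eq0.
apply: contraT => /(n0P n.+1 (leqW n0n) (val a))/peP.
by have /in_ball[_ aN] := valP a; rewrite ltnNge aN.
Qed.

End Filtration.
End Series.

(** * The factorization *)

Section Factorization.
Variables (T : zmodType) (k : fieldType) (P D : set T) (S : {fset T}) (deg : T -> nat).
Hypotheses (degP : degree P deg) (DP : D `<=` P) (D0 : forall x, D x -> x != 0).
Hypothesis D_multiple : forall m i q, D m -> P q -> ~ D q -> q <> m *+ i.+1.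
Hypotheses (SD : forall m, m \in S -> D m) (char0 : [pchar k] =i pred0).

Let factor (m : T) : T -> k := zmon 1 0 + zmon (tree_sum D S k m) m.

(** [conv_binomial] and [forest_sum_add] are the same recursion. *)
Lemma product_forest_sum (s : seq T) : uniq s -> {in s, forall m, D m} ->
  \big[@conv T k / zmon 1 0]_(m <- s) factor m = forest_sum D S k [fset x in s]%fset.
Proof.
elim: s => [_ _|m s IH /= /andP[ms us] sD].
  by rewrite big_nil; apply/funext => y; rewrite -(forest_sum_set0 D S); congr forest_sum;
    apply/fsetP => x; rewrite !inE.
have sD' : {in s, forall m, D m} by move=> x xs; apply: sD; rewrite inE xs orbT.
have Dm : D m by apply: sD; rewrite mem_head.
rewrite big_cons IH //; apply/funext => y; rewrite conv_binomial ?D0 //.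
rewrite fset_cons (forest_sum_add _ degP) //; last by rewrite !inE.
by move=> x /=; rewrite !inE; apply: sD'.
Qed.

Lemma finite_product_forest_sum (A : {fset T}) : [set` A] `<=` D ->
  finite_product factor A = forest_sum D S k A.
Proof.
move=> AD; rewrite /finite_product product_forest_sum ?fset_uniq //.
by congr forest_sum; apply/fsetP => x; rewrite !inE.
Qed.

Lemma factor_series m : D m -> power_series P (factor m).
Proof.
move=> Dm; apply: power_seriesD; apply: power_series_zmon; last exact: DP.
exact: degree_in0 degP.
Qed.

Lemma forest_sum_series (A : {fset T}) : [set` A] `<=` D ->
  power_series P (forest_sum D S k A).
Proof.
move=> AD; rewrite -finite_product_forest_sum //; apply: (finite_product_series degP).
by move=> m mA; apply/factor_series/AD.
Qed.

Lemma vanishing_trunc N (h : T -> k) : h 0 = 1 ->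
  vanishing 1 (trunc (ball_truncation degP N) h - 1).
Proof.
move=> h0 a; rewrite ltnS leqn0 => /eqP da.
have /(in_ball degP)[Pa _] := valP a.
have a0 : val a = 0.
  by apply/eqP; apply: contraT => /(degree_gt0 degP Pa); rewrite da.
by rewrite -trunc1 -truncB truncE a0 addrfctE opprfctE h0 /zmon eqxx subrr.
Qed.

(** The powers of a monomial sit at positive multiples of its exponent, which [D_multiple] keeps
    apart from the elements of [P] outside [D]. *)
Lemma log_sum_zmon N n t m (a : exponents (ball_truncation degP N)) :
  D m -> P (val a) -> ~ D (val a) ->
  (log_sum (log_coef k degP N) n (trunc _ (zmon t m)) : truncated k _) a = 0.
Proof.
move=> Dm Pa nDa; rewrite /log_sum; apply: (big_ind (fun x : truncated k _ => x a = 0)).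
- exact: truncated0E.
- by move=> x y x0 y0; rewrite truncatedDE x0 y0 addr0.
- move=> i _; rewrite trunc_constM; apply/eqP; rewrite mulf_eq0; apply/orP; right.
  apply: contraT => /trunc_zmonX am; case: (D_multiple (i := i) Dm Pa nDa am).
Qed.

Variables f L : T -> k.
Hypotheses (fP : power_series P f) (f0 : f 0 = 1).
Hypothesis fD : forall m, D m -> f m = (m \in S)%:R.
Hypothesis Llog : is_log P f L.
Hypothesis L0 : forall q, P q -> ~ D q -> q != 0 -> L q = 0.
Hypothesis powersP : forall m j, power_exponents P j m <-> P m /\ (j <= deg m)%N.

Lemma forest_sum_coef (A : {fset T}) y : [set` A] `<=` D -> P y ->
  (forall x, D x -> (deg x <= deg y)%N -> x \in A) -> forest_sum D S k A y = f y.
Proof.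
move=> AD Py ballA.
case: (eqVneq y 0) => [->|y0]; first by rewrite (forest_sum0 _ degP) // f0.
case: (pselect (D y)) => [Dy|nDy]; first by rewrite (forest_sum_root _ degP) // fD.
have yS : y \notin S by apply/negP => /SD.
pose N := deg y; pose B := ball_truncation degP N.
pose A' := [fset x in ball P deg N | `[< D x >]]%fset.
have A'E x : x \in A' <-> D x /\ (deg x <= N)%N.
  rewrite !inE /=; split=> [/andP[/(in_ball degP)[_ xN] /asboolP]//|[Dx xN]].
  by apply/andP; split; [apply/(in_ball degP); split=> //; apply: DP|apply/asboolP].
have A'D : [set` A'] `<=` D by move=> x /A'E[].
(* The sum over trees does not depend on [A], so [A] may be replaced by [A'], whose labels all have
   degree at most [N]. *)
rewrite (forest_sum_curve degP DP D0 k AD y0 nDy yS) //.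
rewrite -(forest_sum_curve degP DP D0 k A'D y0 nDy yS); last first.
  by move=> x Dx xN; apply/A'E.
have yB : y \in exponents B by apply/(in_ball degP).
have [n0 n0P] := log_sum_log degP N fP Llog (fun j m h => proj2 (proj1 (powersP m j) h)).
(* Beyond [n0] the partial sums give the logarithm of [f]; twice the nilpotency order N + 1 is what
   additivity asks for. *)
pose n := (n0 + (N.+1 + N.+1))%N.
suff /(congr1 (fun u => u + 1)) : trunc B (forest_sum D S k A') - 1 = trunc B f - 1.
  rewrite !subrK => /(congr1 (fun u : truncated k B => u [` yB]%fset)).
  rewrite !truncE => h; exact: h.
have sum0 : forest_sum D S k A' 0 = 1 by apply: (forest_sum0 _ degP).
(* Off [E] the two series agree, by the constant term and the count at labels in [D]; on [E] both
   logarithms vanish. *)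
apply: (log_sum_inj char0 (n := n) (E := [set q | [/\ P q, ~ D q & q != 0]])).
- by rewrite /n addn_gt0 orbT.
- exact: vanishing_trunc.
- exact: vanishing_trunc.
- move=> a nEa; have /(in_ball degP)[Pa aN] := valP a.
  rewrite -trunc1 -!truncB !truncE !addrfctE; congr (_ + _).
  case: (eqVneq (val a) 0) => [->|a0]; first by rewrite sum0 f0.
  have Da : D (val a) by apply: contrapT => nDa; apply: nEa.
  rewrite fD // (forest_sum_root _ degP) // => x Dx xa.
  by apply/A'E; split=> //; exact: leq_trans aN.
- move=> a [Pa nDa a0]; transitivity (L (val a)); last exact/esym/n0P/leq_addr.
  rewrite L0 //.
  rewrite -finite_product_forest_sum // trunc_product; last first.
    by move=> m mA; apply/factor_series/A'D.
  under eq_bigr do rewrite truncD trunc1.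
  rewrite (log_sum_prod (log_coefE degP N char0) (K := N.+1) (J := vanishing 1)).
  + rewrite big_seq; apply: (big_ind (fun x : truncated k B => x a = 0)).
    * exact: truncated0E.
    * by move=> x z x0 z0; rewrite truncatedDE x0 z0 addr0.
    * by move=> m /A'D Dm; apply: log_sum_zmon.
  + exact: leq_addl.
  + by move=> b _; exact: truncated0E.
  + move=> u v u1 v1; apply: vanishingD; first exact: vanishingD.
    by apply: vanishing_le (vanishingM u1 v1).
  + by move=> u; exact: vanishing_nilpotent.
  + move=> m /A'E[Dm _] b; rewrite ltnS leqn0 truncE /zmon => /eqP b0.
    case: eqP => // bm; have := degree_gt0 degP (DP Dm) (D0 Dm).
    by rewrite -bm b0.
Qed.

(** As soon as [A] contains all labels of degree at most [j], the finite product has the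
    coefficients of [f] in degrees below [j]. *)
Lemma is_product_factor : is_product P D factor f.
Proof.
move=> j; have finB : finite_set [set x | D x /\ (deg x <= j)%N].
  by apply: sub_finite_set (degree_ball degP j) => x [/DP].
exists (fset_set [set x | D x /\ (deg x <= j)%N]).
  by move=> x /=; rewrite in_fset_set // inE => -[].
move=> A sub AD; rewrite finite_product_forest_sum // => m.
rewrite addrfctE opprfctE => fm; case: (pselect (P m)) => [Pm|nPm]; last first.
  move: fm; have [->|/fP //] := eqVneq (f m) 0.
  by rewrite add0r oppr_eq0 => /(forest_sum_series AD).
apply/powersP; split=> //; rewrite leqNgt; apply: contraNN fm => mj.
rewrite forest_sum_coef ?subrr // => x Dx xm; apply: sub.
by rewrite /= in_fset_set // inE; split=> //; apply: leq_trans (ltnW mj).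
Qed.

Lemma curve_coef q : P q -> ~ D q -> q != 0 ->
  f q = \sum_(Phi \in tree D S q) (-1 : k) ^+ (tree_nonleaves Phi).-1.
Proof.
move=> Pq nDq q0; have qS : q \notin S by apply/negP => /SD.
have finB : finite_set [set x | D x /\ (deg x <= deg q)%N].
  by apply: sub_finite_set (degree_ball degP (deg q)) => x [/DP].
pose A := fset_set [set x | D x /\ (deg x <= deg q)%N].
have AE x : x \in A <-> D x /\ (deg x <= deg q)%N by rewrite in_fset_set // inE.
have AD : [set` A] `<=` D by move=> x /AE[].
have ballA x : D x -> (deg x <= deg q)%N -> x \in A by move=> Dx xq; apply/AE.
by rewrite -(forest_sum_coef AD Pq ballA) (forest_sum_curve degP DP D0 k AD q0 nDq qS).
Qed.

End Factorization.

(** * The case of a submonoid of Z^n + Q^gp *)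

Theorem proposition5p2 (k : fieldType) (char0 : [pchar k] =i pred0)
  (n : nat) (Qgp : zmodType) (Q : set Qgp)
  (toricQ : toric_monoid Q) (gpQ : gp Q = [set: Qgp])
  (P : set ('rV[int]_n * Qgp)%type)
  (toricP : toric_monoid P) (unitsP : trivial_units P)
  (QE : zero_oplus n Q = [set m | P m /\ m.1 = 0])
  (S : {fset ('rV[int]_n * Qgp)%type})
  (SP : forall m, m \in S -> P m /\ m.1 != 0)
  (b g f : ('rV[int]_n * Qgp)%type -> k)
  (gE : g = zsum (zero_oplus n Q `\ 0) b)
  (fE : f = zmon 1 0 + \sum_(m <- S) zmon 1 m + g)
  (fN : normalized P (zero_oplus n Q) f) :
  let a (m : ('rV[int]_n * Qgp)%type) : k :=
    \sum_(X \in disk_types P (zero_oplus n Q) S m) (-1 : k) ^+ nonleaves X in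
  is_product P [set m | P m /\ m.1 != 0]
    (fun m => zmon 1 0 + zmon (a m) m) f /\
  forall q, zero_oplus n Q q -> q != 0 ->
    b q = \sum_(X \in curve_types P (zero_oplus n Q) S q)
            (-1 : k) ^+ (nonleaves X).-1.
Proof.
move=> a; have [[P0 PD] finP _ _] := toricP.
have [deg [degP powersP]] := degree_exists P0 PD finP unitsP.
set D := [set m | P m /\ m.1 != 0].
have DP : D `<=` P by move=> m [].
have D0 m : D m -> m != 0 by move=> [_]; apply: contraNneq => ->.
have PQ : (P `\` zero_oplus n Q)%classic = D.
  rewrite QE; apply/seteqP; split=> m /=.
    by move=> [Pm nQm]; split=> //; apply/eqP => m0; apply: nQm.
  by move=> [Pm /eqP m0]; split=> // -[].
have QP q : zero_oplus n Q q -> P q /\ ~ D q.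
  by rewrite QE => -[Pq q0]; split=> // -[_ /eqP].
(* Integer row vectors have no torsion, so a positive multiple of [m] has zero first component only
   if [m] does. *)
have D_multiple m i q : D m -> P q -> ~ D q -> q <> m *+ i.+1.
  move=> [_ m0] Pq nDq qE; apply: nDq; split=> //; apply: contraNneq m0.
  rewrite qE (raddfMn fst) /= => m0; apply/eqP/rowP => j; rewrite mxE.
  by move/rowP/(_ j): m0; rewrite mulmxnE mxE => /eqP; rewrite Num.Theory.mulrn_eq0 => /eqP.
have fQ q : f q = (q == 0)%:R + (q \in S)%:R + g q.
  rewrite fE addrfctE addrfctE fct_sumE; congr (_ + _ + _).
    by rewrite /zmon; case: ifP.
  rewrite /zmon; case: (boolP (q \in S)) => qS.
    rewrite (big_fsetD1 q) //= eqxx big_seq big1 ?addr0 // => m.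
    by rewrite in_fsetD1 eq_sym => /andP[/negbTE->].
  by rewrite big_seq big1 // => m mS; case: eqP => // qm; rewrite qm mS in qS.
have gQ q : zero_oplus n Q q -> q != 0 -> g q = b q.
  by move=> Qq q0; rewrite gE /zsum ifT // inE; split=> //; apply/eqP.
have gnQ q : ~ (zero_oplus n Q `\ 0) q -> g q = 0.
  by move=> nq; rewrite gE /zsum ifF //; apply/negP; rewrite inE.
have fP : power_series P f.
  move=> q; rewrite fQ; case: (eqVneq q 0) => [->//|q0].
  case: (boolP (q \in S)) => [/SP[]//|_]; rewrite !add0r.
  by apply: contraNP => nPq; apply/eqP/gnQ => -[/QP[]].
have SD m : m \in S -> D m by exact: SP.
have f0 : f 0 = 1.
  rewrite fQ eqxx (_ : 0 \in S = false); last by apply/negP => /SD/D0; rewrite eqxx.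
  by rewrite addr0 gnQ ?addr0 // => -[_]; apply.
have fD m : D m -> f m = (m \in S)%:R.
  move=> Dm; rewrite fQ (negbTE (D0 m Dm)) add0r gnQ ?addr0 // => -[/QP[_]].
  exact.
have [L [Llog LQ]] := fN.
have L0 q : P q -> ~ D q -> q != 0 -> L q = 0.
  move=> Pq nDq; apply: LQ; rewrite QE; split=> //.
  by apply/eqP; apply: contrapT => /negP q0; apply: nDq.
split.
  (* Restricted to [D], because the root label of a disk must itself lie in [D]; no other factors
     occur. *)
  have aE : {in D, a =1 tree_sum D S k}.
    move=> m /set_mem Dm; rewrite /a /tree_sum (disk_typesE S PQ Dm).
    exact: (sum_labelled_types D S m (fun i => (-1 : k) ^+ i)).
  move=> j; have [A0 A0D A0P] :=
    is_product_factor degP DP D0 D_multiple SD char0 fP f0 fD Llog L0 powersP j.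
  exists A0 => // A A0A AD; have := A0P A A0A AD.
  rewrite /finite_product (eq_big_seq (fun m => zmon 1 0 + zmon (a m) m)) // => m mA.
  by rewrite aE // inE; apply: AD.
move=> q Qq q0; have [Pq nDq] := QP q Qq.
rewrite (curve_typesE S PQ Qq) (sum_labelled_types D S q (fun i => (-1 : k) ^+ i.-1)).
rewrite -(curve_coef degP DP D0 D_multiple SD char0 fP f0 fD Llog L0 powersP Pq nDq q0).
rewrite fQ (negbTE q0) add0r gQ // (_ : (q \in S) = false) ?add0r //.
by apply/negP => /SD.
Qed.
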